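(* Let $k\ge 2$ be an integer and let $G$ be a connected graph with minimum degree $\delta\ge 6k-4$ and of order $n\ge 2\delta+2$. If $\rho_D(G)\le\rho_D(M_{n,\delta+1}^{k-1})$, then $\tau(G)\ge k$, unless $G\cong M_{n,\delta+1}^{k-1}$.
   Context: All graphs are finite, undirected and simple. The order of a graph is its number of vertices. $\tau(G)$ is the maximum number of pairwise edge-disjoint spanning trees contained in $G$. For a connected graph $G$ with vertices $v_1,\dots,v_n$, the distance matrix $D(G)$ is the $n\times n$ matrix whose $(i,j)$ entry is the distance $d_G(v_i,v_j)$ (length of a shortest path), and $\rho_D(G)$, the distance spectral radius, is its largest eigenvalue. A matching is a set of edges no two of which share an endpoint. For integers $k\ge 2$, $\delta\ge 6k-4$ and $n\ge 2\delta+2$, $M_{n,\delta+1}^{k-1}$ is the graph obtained from the disjoint union $K_{\delta+1}\cup K_{n-\delta-1}$ of two complete graphs by adding a matching of size $k-1$ between the two complete graphs. *)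

(* Defs.v *)
From HB Require Import structures.
From mathcomp Require Import all_boot all_order all_algebra.
From mathcomp Require Import classical_sets reals.

Set Implicit Arguments.
Unset Strict Implicit.
Unset Printing Implicit Defensive.

Import Order.TTheory GRing.Theory Num.Theory.

Record sgraph := SGraph {
  vertex :> finType;
  adj : rel vertex;
  adj_sym : symmetric adj;
  adj_irrefl : irreflexive adj }.

Definition isomorphic (G H : sgraph) : Prop :=
  exists2 f : G -> H, bijective f & forall x y, adj (f x) (f y) = adj x y.

Definition connected_rel (V : finType) (e : rel V) : bool :=
  [forall x, forall y, connect e x y].

Definition connected_graph (G : sgraph) : bool := connected_rel (@adj G).

(* Degrees are smaller than #|G|, so the default value #|G| never matters on
   a nonempty graph. *)
Definition min_degree (G : sgraph) : nat :=
  \big[minn/#|G|]_(x : G) #|[set y : G | adj x y]|.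

(* A cycle is a duplicate-free closed sequence of at least three vertices;
   being duplicate-free bounds its length by #|V|. *)
Definition acyclic_rel (V : finType) (e : rel V) : bool :=
  [forall m : 'I_#|V|.+1, forall p : m.-tuple V,
     (2 < m) ==> ~~ ucycleb e p].

(* Edges are two-element sets of vertices, and spanning subgraphs are
   represented by their sets of edges. *)
Definition edges (G : sgraph) : {set {set G}} :=
  [set [set u.1; u.2] | u : G * G & adj u.1 u.2].

Definition edge_rel (V : finType) (F : {set {set V}}) : rel V :=
  fun x y => (x != y) && ([set x; y] \in F).

Definition spanning_tree (G : sgraph) (F : {set {set G}}) : bool :=
  [&& F \subset edges G, connected_rel (edge_rel F) & acyclic_rel (edge_rel F)].

(* On at least two vertices a spanning tree has an edge, so edge-disjoint
   spanning trees are distinct and a packing is a set of them. *)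
Definition tree_packing (G : sgraph) (P : {set {set {set G}}}) : bool :=
  [forall F in P, spanning_tree F] && finset.trivIset P.

Definition tau (G : sgraph) : nat :=
  \max_(P : {set {set {set G}}} | tree_packing P) #|P|.

(* Some path from x to y has exactly m edges. *)
Definition has_path (G : sgraph) (x y : G) (m : nat) : bool :=
  [exists p : m.-tuple G,
     [&& path (@adj G) x p, last x p == y & uniq (x :: p)]].

(* A path has fewer than #|G| edges; the value is #|G| when there is no path. *)
Definition dist (G : sgraph) (x y : G) : nat :=
  \big[minn/#|G|]_(m < #|G| | has_path x y m) m.

Definition distance_matrix (R : realType) (G : sgraph) : 'M[R]_#|G| :=
  (\matrix_(i, j) (dist (enum_val i) (enum_val j))%:R)%R.

(* The set of eigenvalues is finite, and nonempty when A is symmetric of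
   positive size, in which case the supremum is a maximum. *)
Definition largest_eigenvalue (R : realType) (n : nat) (A : 'M[R]_n) : R :=
  sup [set a : R | eigenvalue A a]%classic.

Definition distance_spectral_radius (R : realType) (G : sgraph) : R :=
  largest_eigenvalue (distance_matrix R G).

Section TwoCliques.
Variables n m t : nat.

Definition two_cliques_adj : rel ('I_m + 'I_(n - m)) := fun u v =>
  match u, v with
  | inl i, inl j => i != j
  | inr i, inr j => i != j
  | inl i, inr j => (i == j :> nat) && (i < t)
  | inr j, inl i => (i == j :> nat) && (i < t)
  end.

Fact two_cliques_sym : symmetric two_cliques_adj.
Proof. by case=> i [] j //=; rewrite eq_sym. Qed.

Fact two_cliques_irrefl : irreflexive two_cliques_adj.
Proof. by case=> i /=; rewrite eqxx. Qed.

(* M_{n,m}^t: the i-th vertex of K_m is matched to the i-th vertex of K_{n-m}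
   for i < t; this is a matching of size t as long as t <= m and t <= n - m. *)
Definition two_cliques : sgraph :=
  SGraph two_cliques_sym two_cliques_irrefl.

End TwoCliques.

(* Main.v *)
Require Import Defs.
From mathcomp Require Import all_boot all_order all_algebra reals.
From mathcomp Require classical_sets.
From mathcomp Require Import boolp zify ring lra.
Set Implicit Arguments.
Unset Strict Implicit.
Unset Printing Implicit Defensive.

(* By the Nash-Williams-Tutte theorem, tau G < k yields a partition of the
   vertices into t parts with at most k(t - 1) - 1 edges between them, and a part
   with fewer than delta outgoing edges has more than delta vertices.

   If t = 2, G lies inside two cliques joined by at most k - 1 edges.  Put the
   entries of the Perron vector of M = M_{n,delta+1}^{k-1}, which take only four
   values, on the vertices of G, so that the endpoints of the cut edges get the
   entries of the matched vertices.  Two vertices in different parts are at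
   distance at least 3, lowered by one for each endpoint of a cut edge, and the
   resulting lower bound for the distance form of G exceeds the value for M if the
   smaller part has more than delta + 1 vertices.  Otherwise it equals that value,
   and all distances are forced to be those of M.

   If t >= 3, there are three parts with few outgoing edges (and four if t >= 4).
   The distance matrix of M is dominated by the one in which all distances between
   the cliques are 3; its Perron vector takes two values r and 1, where r is the
   root of a quadratic equation.  Put r on delta + 1 vertices of one part of G
   and 1 elsewhere: the distances gained between the other parts outweigh the loss
   at the endpoints of the edges between the parts. *)

(** * The tree packing theorem *)

(** Spectral information is used one-sidedly: a test vector bounds the radius of [G] from below, and
    an eigenvector of [M] with positive entries determines or bounds the radius of [M]. Inside a
    part only the trivial lower bound 1 for distances is used, so the structure of the parts does
    not enter.

    For two parts the bound must be attained by the extremal graph, which forces the exact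
    four-valued vector. For three or more parts there is slack; the coarser vector [(r, 1)]
    suffices, and what remains are polynomial inequalities in part sizes and cuts.

    The constant [6k - 4] says that [delta + 1 >= 3(2k - 1)]: a cut below [2k] is at most a third of
    [delta + 1], and three cuts with sum at most [4k - 2] are together at most two thirds of it. *)

Section Forests.
Variable V : finType.
Implicit Types (F H : {set {set V}}) (x y u v : V).

Local Notation conn F := (connect (edge_rel F)).

Definition all_pairs F := forall e, e \in F -> exists x y, x != y /\ e = [set x; y].

(** Acyclicity as every edge being a bridge, the form that suits edge exchanges; [forest_acyclic]
    passes to cycles. *)
Definition forest F : bool :=
  [forall x, forall y, edge_rel F x y ==> ~~ conn (F :\ [set x; y]) x y].

Lemma forestP F : reflect
  (forall x y, x != y -> [set x; y] \in F -> ~~ conn (F :\ [set x; y]) x y)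
  (forest F).
Proof.
apply: (iffP forallP) => [h x y xy xyF|h x].
  by have /forallP/(_ y)/implyP := h x; apply; rewrite /edge_rel xy.
by apply/forallP => y; apply/implyP => /andP[]; apply: h.
Qed.

Lemma conn_sym F : connect_sym (edge_rel F).
Proof.
by apply: sym_connect_sym => x y; rewrite /edge_rel eq_sym setUC.
Qed.

Lemma conn1 F x y : [set x; y] \in F -> conn F x y.
Proof.
have [<-|xy] := eqVneq x y; first by rewrite connect0.
by move=> xyF; apply: connect1; rewrite /edge_rel xy.
Qed.

Lemma connS F H x y : F \subset H -> conn F x y -> conn H x y.
Proof.
move=> FH; apply: connect_sub => u v /andP[_] /(subsetP FH); exact: conn1.
Qed.

Lemma set2_inj x y u v : [set x; y] = [set u; v] ->
  (x = u /\ y = v) \/ (x = v /\ y = u).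
Proof.
move=> e; have := set21 x y; have := set22 x y; have := set21 u v; have := set22 u v.
rewrite e -[in X in X -> _]e -[in X in _ -> X -> _]e !inE.
by do 4![case/orP=> /eqP ?]; subst; auto.
Qed.

Lemma conn_add F x y u v : conn ([set x; y] |: F) u v =
  [|| conn F u v, conn F u x && conn F y v | conn F u y && conn F x v].
Proof.
have sF : F \subset [set x; y] |: F by apply: subsetUr.
have xy : conn ([set x; y] |: F) x y by apply: conn1; rewrite setU11.
apply/idP/idP => [uv|]; last first.
  case/or3P => [/(connS sF)//|/andP[/(connS sF) ux /(connS sF) yv]|].
    exact: connect_trans ux (connect_trans xy yv).
  move=> /andP[/(connS sF) uy /(connS sF) xv]; apply: connect_trans uy _.
  by rewrite (connect_trans _ xv) // conn_sym.
(* The right-hand side as a predicate in [v]: it holds at [u] and is closed under the edges of the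
   enlarged set. *)
pose a := [pred w | [|| conn F u w, conn F u x && conn F y w | conn F u y && conn F x w]].
have : closed (edge_rel ([set x; y] |: F)) a.
  apply: intro_closed; first exact: conn_sym.
  move=> w z /andP[wz]; rewrite !inE => /orP[/eqP/set2_inj|wzF].
    case=> -[-> ->]; rewrite !connect0 ?andbT.
      by case/or3P => [->|/andP[-> _]|->]; rewrite ?orbT.
    by case/or3P => [->|->|/andP[-> _]]; rewrite ?orbT.
  have wz1 := conn1 wzF.
  case/or3P => [h|/andP[-> h]|/andP[-> h]];
  by rewrite (connect_trans h wz1) ?orbT.
by move=> cl; have := closed_connect cl uv; rewrite !inE connect0 /= => <-.
Qed.

Lemma forestS F H : F \subset H -> forest H -> forest F.
Proof.
move=> FH /forestP fH; apply/forestP => x y xy xyF.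
apply: contra (fH _ _ xy (subsetP FH _ xyF)); apply: connS; exact: setSD.
Qed.

(** If an old edge [uv] stopped being a bridge, the detour around it would run through [xy]; the
    rest of the detour and [uv] would then connect [x] and [y] in [F]. *)
Lemma forest_add F x y : forest F -> ~~ conn F x y -> forest ([set x; y] |: F).
Proof.
move=> fF nxy; apply/forestP => u v uv; rewrite !inE => /orP[/eqP e|uvF].
  have s : ([set x; y] |: F) :\ [set u; v] \subset F.
    by apply/fintype.subsetP => f; rewrite !inE e => /andP[/negPf->].
  apply: contra nxy => /(connS s).
  by case: (set2_inj e) => -[-> ->] //; rewrite conn_sym.
have [e|ne] := eqVneq [set x; y] [set u; v].
  have xyF : [set x; y] \in F by rewrite e.
  by rewrite (conn1 xyF) in nxy.
have -> : ([set x; y] |: F) :\ [set u; v] = [set x; y] |: (F :\ [set u; v]).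
  apply/setP => f; rewrite !inE; case: eqVneq => //= ->.
  by apply/esym/negbTE; rewrite eq_sym orbF.
rewrite conn_add (negPf (forestP _ fF _ _ uv uvF)) /=.
have s : F :\ [set u; v] \subset F by apply: subD1set.
have c := conn1 uvF.
apply: contra nxy => /orP[] /andP[/(connS s) h1 /(connS s) h2].
  by rewrite conn_sym (connect_trans h2) // conn_sym (connect_trans _ c) // conn_sym.
by rewrite (connect_trans h2) // conn_sym (connect_trans _ c) // conn_sym.
Qed.

(** Only the components of [x] and [y] merge, so [rt'] maps the old roots other than that of [y]
    bijectively onto the new roots. *)
Lemma n_comp_add F x y : ~~ conn F x y ->
  n_comp (edge_rel F) V = (n_comp (edge_rel ([set x; y] |: F)) V).+1.
Proof.
set F' := _ |: F => nxy; pose rt := fingraph.root (edge_rel F); pose rt' := fingraph.root (edge_rel F').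
have cF := conn_sym F; have cF' := conn_sym F'.
have sF : F \subset F' by apply: subsetUr.
have rtb : rt y \in roots (edge_rel F) by apply: roots_root.
rewrite /n_comp_mem (cardD1 (rt y)) !inE roots_root //= add1n; congr _.+1.
rewrite -(card_in_image (f := rt')).
  apply: eq_card => z; rewrite !inE andbT; apply/imageP/idP => [[w _ ->]|rz].
    exact: roots_root.
  have rt'K w : conn F' w z -> rt' w = z.
    by move=> /(fingraph.rootP cF'); rewrite /rt' => ->; apply/eqP.
  have [e|ne] := eqVneq (rt z) (rt y).
    exists (rt x).
      rewrite !inE roots_root // !andbT; apply: contra nxy => /eqP/(fingraph.rootP cF).
      by [].
    apply/esym/rt'K; rewrite cF' conn_add; apply/or3P/Or33; apply/andP; split.
      exact/(fingraph.rootP cF).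
    exact: connect_root.
  exists (rt z); first by rewrite !inE ne roots_root.
  by apply/esym/rt'K; rewrite cF'; apply: connS sF _; apply: connect_root.
move=> u v; rewrite !inE !andbT => /andP[uy /eqP ru] /andP[vy /eqP rv] /(fingraph.rootP cF').
have nuy : ~~ conn F u y.
  by apply: contra uy => /(fingraph.rootP cF); rewrite ru => ->.
have nvy : ~~ conn F y v.
  by apply: contra vy; rewrite cF => /(fingraph.rootP cF); rewrite rv => ->.
rewrite conn_add (negPf nuy) (negPf nvy) andbF !orbF => /(fingraph.rootP cF).
by rewrite ru rv.
Qed.

Lemma forest_card F : all_pairs F -> forest F ->
  #|F| + n_comp (edge_rel F) V = #|V|.
Proof.
have [m] := ubnP #|F|; elim: m F => // m IHm F Fm pF fF.
have [->|[f fF']] := set_0Vmem F.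
  rewrite cards0 add0n; apply: eq_card => x; rewrite !inE andbT.
  have /connectP[[|z p] /=] := connect_root (edge_rel set0) x.
    by move=> _ /eqP.
  by rewrite /edge_rel inE andbF.
have [x [y [xy fE]]] := pF _ fF'.
have := forestP _ fF x y xy; rewrite -fE => /(_ fF') => nxy.
have := n_comp_add nxy; rewrite -fE setD1K // => nc.
have := IHm (F :\ f); rewrite (cardsD1 f) fF' in Fm * => /(_ _ _ _) h.
have : #|F :\ f| + n_comp (edge_rel (F :\ f)) V = #|V|.
  apply: h; first by rewrite -ltnS in Fm.
    by move=> e; rewrite inE => /andP[_]; apply: pF.
  by apply: forestS fF; apply: subD1set.
rewrite nc => <-; lia.
Qed.

End Forests.

(** * Edge exchanges in a maximal packing of forests *)

Section ForestPacking.
Variables (V : finType) (E : {set {set V}}) (k : nat).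
Hypothesis pairsE : all_pairs E.

Local Notation conn F := (connect (edge_rel F)).
Local Notation family := {ffun 'I_k -> {set {set V}}}.
Implicit Types F H : family.

Definition packing F : bool :=
  [forall i, (F i \subset E) && forest (F i)] &&
  [forall i, forall j, (i != j) ==> [disjoint F i & F j]].

Definition covered F : {set {set V}} := \bigcup_i F i.
Definition weight F := \sum_i #|F i|.

Definition replace F i (A : {set {set V}}) : family :=
  [ffun j => if j == i then A else F j].

Lemma packingP F : reflect
  [/\ forall i, F i \subset E, forall i, forest (F i) &
      forall i j e, e \in F i -> e \in F j -> i = j] (packing F).
Proof.
apply: (iffP andP) => [[/forallP h1 /forallP h2]|[h1 h2 h3]]; split.
- by move=> i; case/andP: (h1 i).
- by move=> i; case/andP: (h1 i).
- move=> i j e ei ej; apply/eqP; apply/negPn/negP => ij.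
  have /forallP/(_ j) := h2 i; rewrite ij /= disjoint_subset => /fintype.subsetP/(_ _ ei).
  by rewrite inE ej.
- by apply/forallP => i; rewrite h1 h2.
- apply/forallP => i; apply/forallP => j; apply/implyP; apply: contraR.
  by rewrite -setI_eq0 => /set0Pn[e /setIP[ei ej]]; apply/eqP/(h3 _ _ e).
Qed.

Lemma weight_replace F i A : weight (replace F i A) + #|F i| = weight F + #|A|.
Proof.
rewrite /weight (bigD1 i) //= [in RHS](bigD1 i) //= ffunE eqxx.
rewrite (eq_bigr (fun j => #|F j|)) => [|j /negPf ji]; last by rewrite ffunE ji.
by rewrite -addnA [RHS]addnC; congr (_ + _); rewrite addnC.
Qed.

Lemma packing_replace F i (A : {set {set V}}) :
  packing F -> A \subset E -> forest A -> [disjoint A & covered F :\: F i] ->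
  packing (replace F i A).
Proof.
move=> /packingP[sF fF dF] sA fA dA.
have nA j e : j != i -> e \in A -> e \in F j -> False.
  move=> ji eA ej; move: dA; rewrite disjoint_subset => /fintype.subsetP/(_ _ eA).
  rewrite !inE negb_and negbK => /orP[ei|/bigcupP[]]; last by exists j.
  by move/eqP: ji; apply; apply: dF ej ei.
apply/packingP; split=> [j|j|j l e]; rewrite !ffunE; do ?by case: ifP.
case: (eqVneq j i) => [->|ji]; case: (eqVneq l i) => [->|li] //.
- by move=> ? /nA => /(_ li).
- by move=> /nA h /h => /(_ ji).
- exact: dF.
Qed.

Variable F0 : family.

(** An exchange swaps an edge of one forest for an uncovered edge. Starting from a packing, it
    preserves the packing property and the number of edges, hence maximality. *)
Inductive reach : family -> Prop :=
| reach_refl : reach F0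
| reach_exchange F i x y f : reach F -> [set x; y] \in E :\: covered F ->
    f \in F i -> forest ([set x; y] |: (F i :\ f)) ->
    reach (replace F i ([set x; y] |: (F i :\ f))).

(** The edges that some sequence of exchanges leaves uncovered. Their components become the parts of
    the sparse partition. *)
Definition exchange_edges : {set {set V}} :=
  [set e | `[< exists2 F, reach F & e \in E :\: covered F >]].

Local Notation E0 := exchange_edges.

Hypothesis packF0 : packing F0.
Hypothesis maxF0 : forall F, packing F -> weight F <= weight F0.

Lemma mem_covered F i e : e \in F i -> e \in covered F.
Proof. by move=> ei; apply/bigcupP; exists i. Qed.

Lemma reach_packing F : reach F -> packing F /\ weight F = weight F0.
Proof.
elim=> {F} [//|F i x y f _ [pF wF] /setDP[xyE xyF] fi fo].
have [sF fF dF] := packingP _ pF.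
have nxyi : [set x; y] \notin F i by apply: contra xyF; apply: mem_covered.
split; last first.
  have := weight_replace F i ([set x; y] |: (F i :\ f)).
  by rewrite cardsU1 !inE (negPf nxyi) andbF (cardsD1 f (F i)) fi wF => /addIn.
apply: packing_replace => //.
  apply/fintype.subsetP => e; rewrite !inE => /orP[/eqP->//|/andP[_]].
  exact: (fintype.subsetP (sF i)).
rewrite disjoint_subset; apply/fintype.subsetP => e; rewrite !inE.
by case/orP => [/eqP->|/andP[_ ->]]; rewrite ?negb_and ?negbK ?xyF ?orbT.
Qed.

(* [F i + xy] is not a forest, by maximality, so [x] and [y] are connected in
   [F i]; each edge of a minimal connecting set can be exchanged for [xy], and is
   then left uncovered. *)
Lemma reach_conn F i x y : x != y -> reach F -> [set x; y] \in E :\: covered F ->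
  conn (F i :&: E0) x y.
Proof.
move=> xy rF xyEF; have [pF wF] := reach_packing rF.
have [sF fF dF] := packingP _ pF.
have /setDP[xyE xyF] := xyEF.
have nxyi : [set x; y] \notin F i by apply: contra xyF; apply: mem_covered.
have cxy : conn (F i) x y.
  apply/negPn/negP => /(forest_add (fF i)) fo.
  have := weight_replace F i ([set x; y] |: F i).
  have := maxF0 (F := replace F i ([set x; y] |: F i)).
  rewrite cardsU1 nxyi wF => h.
  suff /h : packing (replace F i ([set x; y] |: F i)) by lia.
  apply: packing_replace => //.
    by rewrite subUset sub1set xyE sF.
  rewrite disjoint_subset; apply/fintype.subsetP => e; rewrite !inE.
  by case/orP => [/eqP->|->]; rewrite ?negb_and ?negbK ?xyF ?orbT.
have [H /minsetP[/andP[HF cH] minH] _] :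
    {H : {set {set V}} | minset [pred H : {set {set V}} | (H \subset F i) && conn H x y] H
       & H \subset F i}.
  by apply: minset_exists; rewrite /= subxx.
apply: (connS _ cH); apply/fintype.subsetP => f fH.
have fi := fintype.subsetP HF _ fH.
rewrite inE fi inE; apply/asboolP.
have [u [v [uv fE]]] := pairsE (fintype.subsetP (sF i) _ fi).
have sD : H :\ f \subset F i :\ f by apply: setSD.
have nxy : ~~ conn (F i :\ f) x y.
  have nuv := forestP _ (fF i) u v uv; rewrite -fE in nuv.
  have nH : ~~ conn (H :\ f) x y.
    apply/negP => c; have := minH (H :\ f).
    rewrite /= c (subset_trans _ HF) ?subD1set // => /(_ isT isT) e.
    by move: fH; rewrite -e !inE eqxx.
  move: cH; rewrite -(setD1K fH) fE conn_add -fE (negPf nH) /=.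
  apply/contraTN => c; apply: contra (nuv fi).
  rewrite (conn_sym _ u v).
  case/orP => /andP[/(connS sD) h1 /(connS sD) h2].
    by apply: connect_trans h2 _; rewrite conn_sym (connect_trans _ c) // conn_sym.
  rewrite conn_sym; apply: connect_trans h2 _.
  by rewrite conn_sym (connect_trans _ c) // conn_sym.
exists (replace F i ([set x; y] |: (F i :\ f))).
  apply: reach_exchange => //; apply: forest_add => //.
  by apply: forestS (fF i); apply: subD1set.
rewrite inE (fintype.subsetP (sF i)) // andbT.
apply/bigcupP => -[j _]; rewrite ffunE; case: eqVneq => [_|ji] fj.
  move: fj; rewrite !inE eqxx /= orbF => /eqP e.
  by rewrite -e fi in nxyi.
by move/eqP: ji; apply; apply: dF fj fi.
Qed.

(** An exchange adds a single edge [xy] to a forest, and [reach_conn] replaces it by a path of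
    exchange edges in the forest before the exchange. Induction leads back to [F0]. *)
Lemma reach_conn0 F i x y : reach F -> conn (F i :&: E0) x y -> conn (F0 i :&: E0) x y.
Proof.
move=> rF; elim: rF i x y => {F} [//|F j x y f rF IH xyE fj fo] i u v c.
apply: IH; move: c; rewrite ffunE; case: eqVneq => [->|//].
apply: connect_sub => w z /andP[wz]; rewrite !inE => /andP[/orP[/eqP e|/andP[_ wzF]] wz0].
  by apply: reach_conn => //; rewrite e.
by apply: conn1; rewrite !inE wzF.
Qed.

(** The heart of the packing theorem: on each component of the exchange edges, every forest of [F0]
    restricts to a spanning tree. *)
Lemma exchange_edges_conn i x y : conn E0 x y -> conn (F0 i :&: E0) x y.
Proof.
apply: connect_sub => u v /andP[uv]; rewrite inE => /asboolP[F rF uvE].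
apply: (reach_conn0 rF); exact: reach_conn.
Qed.

End ForestPacking.

Definition crossing (V : finType) (r : V -> V) (e : {set V}) : bool :=
  [exists x in e, exists y in e, r x != r y].

Lemma crossing2 (V : finType) (r : V -> V) x y : crossing r [set x; y] = (r x != r y).
Proof.
rewrite /crossing; apply/exists_inP/idP => [[u]|xy]; last first.
  by exists x; rewrite ?set21 //; apply/exists_inP; exists y; rewrite ?set22.
rewrite !inE => uxy /exists_inP[v]; rewrite !inE => vxy.
by case/orP: uxy => /eqP->; case/orP: vxy => /eqP->; rewrite ?eqxx // eq_sym.
Qed.

(* Nash-Williams and Tutte; the parts are the fibres of the idempotent map [r]. *)
Theorem tree_packing_theorem (V : finType) (E : {set {set V}}) (k : nat) :
  0 < #|V| -> all_pairs E ->
  (exists F : {ffun 'I_k -> {set {set V}}},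
     packing E F /\ forall i, connected_rel (edge_rel (F i))) \/
  (exists r : V -> V, (forall x, r (r x) = r x) /\
     #|[set e in E | crossing r e]| + k < k * #|[set r x | x : V]|).
Proof.
move=> V0 pE.
have p0 : packing E [ffun _ : 'I_k => set0].
  apply/packingP; split=> i; rewrite ?ffunE ?sub0set //.
    by apply/forestP => x y _; rewrite inE.
  by move=> j e; rewrite !ffunE inE.
have [F pF maxF] := arg_maxnP (@weight V k) p0.
have [/forallP cF|/forallPn[i0 ni0]] := boolP [forall i, connected_rel (edge_rel (F i))].
  by left; exists F.
right; have [sF fF dF] := packingP _ _ pF.
set E0 := exchange_edges E F; pose r := fingraph.root (edge_rel E0).
have c0 := conn_sym E0.
exists r; split; first by move=> x; apply: root_root.
have rE : #|[set r x | x : V]| = n_comp (edge_rel E0) V.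
  apply: eq_card => z; rewrite !inE andbT; apply/imsetP/idP => [[x _ ->]|/eqP rz].
    exact: roots_root.
  by exists z.
(* These edges form spanning trees of the parts. The other edges of [F i] therefore number the parts
   minus the components of [F i]. *)
pose inn i := [set e in F i | ~~ crossing r e].
have crossP x y : (r x == r y) = connect (edge_rel E0) x y.
  by rewrite /r (root_connect c0).
have innE i : connect (edge_rel (inn i)) =2 connect (edge_rel E0).
  move=> x y; apply/idP/idP.
    apply: connect_sub => u v /andP[_]; rewrite inE crossing2 negbK crossP => /andP[_].
    by [].
  move=> /(exchange_edges_conn pE pF maxF i); apply: connect_sub => u v /andP[uv].
  rewrite inE => /andP[uvF uvE]; apply: conn1.
  by rewrite inE uvF crossing2 negbK crossP conn1.
have pairsF i : all_pairs (F i) by move=> e /(fintype.subsetP (sF i)); apply: pE.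
have cardF i : #|[set e in F i | crossing r e]| + n_comp (edge_rel (F i)) V
    = n_comp (edge_rel E0) V.
  have := forest_card (pairsF i) (fF i).
  have sI : inn i \subset F i by apply/fintype.subsetP => e; rewrite inE => /andP[].
  have := forest_card (F := inn i) _ (forestS sI (fF i)).
  rewrite (eq_n_comp (innE i)) => /(_ _) <-; last first.
    by move=> e /(fintype.subsetP sI); apply: pairsF.
  have : #|F i| = #|inn i| + #|[set e in F i | crossing r e]|.
    rewrite -(cardsID [set e | crossing r e] (F i)) addnC; congr (_ + _).
      by apply: eq_card => e; rewrite !inE andbC.
    by apply: eq_card => e; rewrite !inE.
  lia.
(* An edge left uncovered by [F] is an exchange edge and lies inside a part, so all crossing edges
   belong to the forests. *)
have cover : #|[set e in E | crossing r e]| <= \sum_i #|[set e in F i | crossing r e]|.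
  apply: leq_trans (_ : #|\bigcup_i [set e in F i | crossing r e]| <= _); last first.
    by apply: (big_ind2 (fun (A : {set {set V}}) m => #|A| <= m)) => [|A m B l Am Bl|i _];
    rewrite ?cards0 // (leq_trans (leq_card_setU _ _)) // leq_add.
  apply/subset_leq_card/fintype.subsetP => e; rewrite inE => /andP[eE cr].
  have [/bigcupP[i _ ei]|nc] := boolP (e \in covered F).
    by apply/bigcupP; exists i => //; rewrite inE ei.
  have e0 : e \in E0.
    by rewrite inE; apply/asboolP; exists F; [left | rewrite inE nc].
  have [x [y [xy eE']]] := pE _ eE; move: cr e0; rewrite eE' crossing2 => /negP cr e0.
  by case: cr; rewrite crossP conn1.
have nc1 i : 1 <= n_comp (edge_rel (F i)) V.
  have /card_gt0P[x _] := V0; apply/card_gt0P; exists (fingraph.root (edge_rel (F i)) x).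
  by rewrite !inE roots_root //; apply: conn_sym.
have nc2 : 2 <= n_comp (edge_rel (F i0)) V.
  move: ni0 => /forallPn[x /forallPn[y nxy]].
  rewrite /n_comp_mem; apply/card_gt1P.
  exists (fingraph.root (edge_rel (F i0)) x), (fingraph.root (edge_rel (F i0)) y).
  have cs := conn_sym (F i0).
  by rewrite !inE !roots_root // root_connect // nxy.
have : \sum_i (#|[set e in F i | crossing r e]| + n_comp (edge_rel (F i)) V)
    = k * n_comp (edge_rel E0) V.
  by rewrite (eq_bigr _ (fun i _ => cardF i)) sum_nat_const card_ord.
rewrite big_split /= rE => <-.
(* Every forest has a component and the one at [i0] has two, whence the strict inequality. *)
have : k < \sum_i n_comp (edge_rel (F i)) V.
  rewrite (bigD1 i0) //=.
  have : \sum_(i | i != i0) 1 <= \sum_(i | i != i0) n_comp (edge_rel (F i)) V.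
    by apply: leq_sum => i _.
  have := cardC1 i0; rewrite card_ord sum1_card => ->.
  move=> h; apply: leq_trans (leq_add nc2 h); have := ltn_ord i0; lia.
by move=> h; rewrite -addnS leq_add.
Qed.

(** * Spanning trees, degrees and distances in a graph *)

Section Tau.
Variable G : sgraph.

Lemma edgesP (x y : G) : ([set x; y] \in edges G) = adj x y.
Proof.
apply/imsetP/idP => [[[u v]]|xy]; last by exists (x, y); rewrite ?inE.
rewrite inE /= => uv /set2_inj; case=> -[-> ->] //; by rewrite adj_sym.
Qed.

Lemma edges_pairs : all_pairs (edges G).
Proof.
move=> e /imsetP[[u v]]; rewrite inE /= => uv ->; exists u, v; split=> //.
by apply: contraTneq uv => ->; rewrite adj_irrefl.
Qed.

(** In a cycle [x, y, z, ...] the edges other than [xy] still join [y] to [x], so [xy] is not a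
    bridge. That none of them equals [xy] follows from the absence of repetitions. *)
Lemma forest_acyclic (V : finType) (F : {set {set V}}) : forest F -> acyclic_rel (edge_rel F).
Proof.
move=> /forestP fF; apply/forallP => m; apply/forallP => -[p /= /eqP pm]; apply/implyP => m2.
apply/negP => /andP[]; case: p pm => [|x [|y [|z p]]] /= pm; try by rewrite -pm in m2.
rewrite rcons_path => /and3P[/andP[xy xyF] yz /andP[zp /andP[lx lxF]]].
rewrite !inE !negb_or => /andP[/and3P[_ xz xp] /and3P[/andP[yz' yp] zp' up]].
have /negP := fF _ _ xy xyF; apply; rewrite conn_sym.
set F' := _ :\ _.
have xs (u v : V) : u != x -> v != x -> edge_rel F u v -> edge_rel F' u v.
  move=> ux vx /andP[uv uvF]; rewrite /edge_rel uv !inE uvF andbT.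
  by apply/eqP => /set2_inj[] -[e1 e2]; [rewrite e1 eqxx in ux | rewrite e2 eqxx in vx].
have yx : y != x by rewrite eq_sym.
have zx : z != x by rewrite eq_sym.
have cz w q : w != x -> x \notin q -> path (edge_rel F) w q ->
    connect (edge_rel F') w (last w q) /\ last w q != x.
  elim: q w => [|u q IH] w wx /=; first by rewrite connect0.
  rewrite inE negb_or => /andP[xu xq] /andP[wu uq].
  have ux : u != x by rewrite eq_sym.
  have [c l] := IH u ux xq uq; split => //.
  by apply: connect_trans (connect1 _) c; apply: xs.
have [c l] := cz z p zx xp zp.
apply: connect_trans (connect1 (xs _ _ yx zx yz)) _.
apply: connect_trans c (connect1 _).
rewrite /edge_rel lx !inE lxF andbT; apply/eqP => /set2_inj[] -[e1 e2].
  by rewrite e1 eqxx in l.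
have : last z p \in z :: p by apply: mem_last.
by rewrite e1 inE (negPf yz') (negPf yp).
Qed.

(** A connected forest on at least two vertices has an edge, so the disjoint forests are distinct
    and form a set of [k] elements. *)
Lemma packing_tau k (F : {ffun 'I_k -> {set {set G}}}) :
  1 < #|G| -> packing (edges G) F -> (forall i, connected_rel (edge_rel (F i))) ->
  k <= tau G.
Proof.
move=> /card_gt1P[x [y [_ _ xy]]] /packingP[sF fF dF] cF.
have F0 i : exists e, e \in F i.
  have /forallP/(_ x)/forallP/(_ y)/connectP[[|z p] /=] := cF i.
    by move=> _ e; rewrite e eqxx in xy.
  by move=> /andP[/andP[_ h] _] _; exists [set x; z].
have injF : injective F.
  by move=> i j e; have [f fi] := F0 i; apply: (dF _ _ f) => //; rewrite -e.
have kE : #|F @: 'I_k| = k by rewrite card_imset // card_ord.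
rewrite /tau -[leqLHS]kE; apply: (@leq_bigmax_cond _ _ (fun P : {set {set {set G}}} => #|P|)).
apply/andP; split.
  apply/forallP => A; apply/implyP => /imsetP[i _ ->]; apply/and3P; split=> //.
  exact: forest_acyclic.
apply/trivIsetP => _ _ /imsetP[i _ ->] /imsetP[j _ ->] ij.
rewrite -setI_eq0; apply: contraNT ij => /set0Pn[e /setIP[ei ej]].
by rewrite (dF i j e).
Qed.

Lemma min_degree_le (x : G) : min_degree G <= #|[set y | adj x y]|.
Proof.
rewrite /min_degree; have := mem_index_enum x.
elim: (index_enum _) => // u s IH; rewrite inE big_cons => /orP[/eqP<-|/IH h].
  exact: geq_minl.
by apply: leq_trans h; apply: geq_minr.
Qed.

(** [#|G|] is the default value of the minimum, so any smaller value comes from a path. *)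
Lemma dist_lt (x y : G) : dist x y < #|G| -> has_path x y (dist x y).
Proof.
rewrite /dist; set d := \big[_/_]_(_ < _ | _) _.
suff : (d = #|G|) \/ has_path x y d by case=> // ->; rewrite ltnn.
rewrite /d; elim/big_ind: _ => [|a b ha hb|m hm]; [by left| |by right].
by rewrite /minn; case: ifP.
Qed.

Lemma dist_le (x y : G) m : has_path x y m -> dist x y <= m.
Proof.
move=> h; have mG : m < #|G|.
  case/existsP: h => p /and3P[_ _ u].
  by rewrite (leq_trans _ (max_card (mem (x :: p)))) // (card_uniqP u) /= size_tuple.
rewrite /dist; have := mem_index_enum (Ordinal mG).
elim: (index_enum _) => // u s IH; rewrite inE big_cons => /orP[/eqP<-|/IH ms].
  by rewrite h; apply: geq_minl.
by case: ifP => // _; apply: leq_trans ms; apply: geq_minr.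
Qed.

Lemma has_path0 (x y : G) : has_path x y 0 -> x = y.
Proof. by case/existsP => p; rewrite tuple0 /= => /andP[/eqP]. Qed.

Lemma has_path1 (x y : G) : has_path x y 1 -> adj x y.
Proof.
case/existsP => -[[|z [|]]] //= i /and3P[/andP[xz _] /eqP<- _].
by [].
Qed.

Lemma has_path2 (x y : G) : has_path x y 2 -> exists2 z, adj x z & adj z y.
Proof.
case/existsP => -[[|z [|w [|]]]] //= i /and3P[/and3P[xz zw _] /eqP<- _].
by exists z.
Qed.

Lemma distxx (x : G) : dist x x = 0.
Proof.
apply/eqP; rewrite -leqn0; apply: dist_le; apply/existsP; exists [tuple] => /=.
by rewrite eqxx.
Qed.

Lemma dist_ge1 (x y : G) : x != y -> 1 <= dist x y.
Proof.
move=> xy; rewrite lt0n; apply: contraNneq xy => d0.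
have G0 : 0 < #|G| by apply/card_gt0P; exists x.
by have := @dist_lt x y; rewrite d0 => /(_ G0) /has_path0->.
Qed.

Lemma dist_ge2 (x y : G) : x != y -> ~~ adj x y -> 2 <= dist x y.
Proof.
move=> xy nxy; have := dist_ge1 xy; rewrite leq_eqVlt => /orP[/eqP d1|//].
have G1 : 1 < #|G| by apply/card_gt1P; exists x, y.
have := @dist_lt x y; rewrite -d1 => /(_ G1) /has_path1 h.
by rewrite h in nxy.
Qed.

Lemma dist_ge3 (x y : G) : 2 < #|G| -> x != y -> ~~ adj x y ->
  (forall z, adj x z -> ~~ adj z y) -> 3 <= dist x y.
Proof.
move=> G2 xy nxy nz; have := dist_ge2 xy nxy; rewrite leq_eqVlt => /orP[/eqP d1|//].
by have := @dist_lt x y; rewrite -d1 => /(_ G2) /has_path2[z /nz /negP].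
Qed.

Lemma dist1 (x y : G) : adj x y -> dist x y = 1.
Proof.
move=> xy; have nxy : x != y by apply: contraTneq xy => ->; rewrite adj_irrefl.
apply/eqP; rewrite eqn_leq dist_ge1 // andbT; apply: dist_le.
by apply/existsP; exists [tuple y]; rewrite /= xy eqxx inE nxy.
Qed.

Lemma dist_le2 (x z y : G) : adj x z -> adj z y -> dist x y <= 2.
Proof.
move=> xz zy; have [->|xy] := eqVneq x y; first by rewrite distxx.
have neq u v : @adj G u v -> u != v by apply: contraTneq => ->; rewrite adj_irrefl.
apply: dist_le; apply/existsP; exists [tuple z; y].
by rewrite /= xz zy eqxx !inE negb_or xy !neq.
Qed.

Lemma dist_le3 (x z w y : G) : adj x z -> adj z w -> adj w y -> dist x y <= 3.
Proof.
move=> xz zw wy; have [->|xy] := eqVneq x y; first by rewrite distxx.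
have [e|xw] := eqVneq x w; first by rewrite e dist1.
have [e|zy] := eqVneq z y; first by rewrite -e dist1.
have neq u v : @adj G u v -> u != v by apply: contraTneq => ->; rewrite adj_irrefl.
apply: dist_le; apply/existsP; exists [tuple z; w; y].
by rewrite /= xz zw wy eqxx !inE !negb_or xy xw zy !neq.
Qed.

Lemma dist_sym (x y : G) : dist x y = dist y x.
Proof.
suff h u v m : @has_path G u v m -> has_path v u m.
  by rewrite /dist; apply: eq_bigl => m; apply/idP/idP; apply: h.
case/existsP => p /and3P[pp /eqP pl up]; apply/existsP.
have sz : size (rev (belast u p)) == m by rewrite size_rev size_belast size_tuple.
exists (Tuple sz) => /=; rewrite -pl rev_path.
rewrite (eq_path (e' := @adj G)) => [|a b]; last by rewrite /= adj_sym.
rewrite pp /=; have e : last u p :: rev (belast u p) = rev (u :: p).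
  by rewrite [in RHS]lastI rev_rcons.
rewrite -cons_uniq e rev_uniq up andbT.
by have := congr1 (last v) e; rewrite /= rev_cons last_rcons => ->.
Qed.

End Tau.

(** * Sparse partitions *)

Section Cuts.
Variable G : sgraph.
Implicit Types (X : {set G}) (r : G -> G).

(** Pairs are oriented out of [X], so each cut edge is counted once. *)
Definition cut X := #|[set a : G * G | [&& adj a.1 a.2, a.1 \in X & a.2 \notin X]]|.

Definition part r (i : G) : {set G} := [set x | r x == i].

(** A vertex of [X] has at most [#|X| - 1] neighbours in [X], so the cut has at least
    [#|X| (delta - #|X| + 1)] edges, which is at least [delta] when [1 <= #|X| <= delta]. *)
Lemma cut_small X delta : (forall x : G, delta <= #|[set y | adj x y]|) ->
  X != set0 -> cut X < delta -> delta < #|X|.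
Proof.
move=> dG X0; apply: contraTT; rewrite -!leqNgt => Xd.
have -> : cut X = \sum_(u in X) #|[set v | adj u v] :\: X|.
  rewrite /cut -sum1_card (partition_big fst [in X]) => [|a]; last first.
    by rewrite inE => /and3P[].
  apply: eq_bigr => u uX; rewrite -sum1_card.
  rewrite (reindex_onto (pair u) snd) => [|[a b]] /=.
    by apply: eq_bigl => v; rewrite !inE /= uX !eqxx !andbT andbC.
  by rewrite inE => /andP[_ /eqP->].
apply: leq_trans (_ : #|X| * (delta - #|X|.-1) <= _).
  have : 0 < #|X| by rewrite card_gt0.
  move: #|X| Xd => m md m0; nia.
rewrite -sum_nat_const; apply: leq_sum => u uX; rewrite leq_subLR.
apply: leq_trans (dG u) _; rewrite -(cardsID X) leq_add2r.
rewrite (cardsD1 u X) uX /=; apply/subset_leq_card/fintype.subsetP => v.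
by rewrite !inE andbC => /andP[-> uv]; rewrite andbT; apply: contraTneq uv => ->; rewrite adj_irrefl.
Qed.

Definition cross_edges r := [set e in edges G | crossing r e].

Lemma cut_part_le r i : cut (part r i) <= #|cross_edges r|.
Proof.
rewrite /cut -(card_in_imset (f := fun a : G * G => [set a.1; a.2])).
  apply/subset_leq_card/fintype.subsetP => e /imsetP[[u v]].
  rewrite !inE /= => /and3P[uv /eqP ui vi] ->; rewrite edgesP uv crossing2 ui eq_sym.
  by [].
move=> [u v] [x y]; rewrite !inE /= => /and3P[_ ui vi] /and3P[_ xi yi].
by case/set2_inj=> -[eu ev]; subst=> //; rewrite ui in yi.
Qed.

(** Each crossing edge is counted once for each of its two orientations. *)
Lemma sum_cut_part r :
  \sum_(i in [set r x | x : G]) cut (part r i) <= 2 * #|cross_edges r|.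
Proof.
have -> : \sum_(i in [set r x | x : G]) cut (part r i) =
    #|[set a : G * G | adj a.1 a.2 && (r a.1 != r a.2)]|.
  rewrite -[RHS]sum1_card (partition_big (fun a => r a.1) [in [set r x | x : G]]) /=.
    apply: eq_bigr => i _; rewrite /cut -sum1_card; apply: eq_bigl => a; rewrite !inE.
    by case: (eqVneq (r a.1) i) => [->|]; rewrite ?andbF // andbT eq_sym.
  by move=> a _; apply: imset_f.
rewrite -sum1_card (partition_big (fun a : G * G => [set a.1; a.2]) [in cross_edges r]) /=.
  rewrite mulnC -sum_nat_const; apply: leq_sum => e; rewrite inE => /andP[/imsetP[[x y] _ ->] _] /=.
  rewrite sum1_card; apply: leq_trans (_ : #|[set (x, y); (y, x)]| <= _); last by rewrite cards2; case: eqP.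
  apply/subset_leq_card/fintype.subsetP => -[u v]; rewrite !inE => /andP[_ /eqP/set2_inj] /=.
  by case=> -[-> ->]; rewrite eqxx ?orbT.
by move=> [x y]; rewrite !inE edgesP crossing2.
Qed.

Lemma part_disjoint r i j : i != j -> [disjoint part r i & part r j].
Proof.
move=> ij; rewrite -setI_eq0; apply/eqP/setP => x; rewrite !inE.
by apply: contraNF ij => /andP[/eqP<-].
Qed.

Lemma part_neq0 r i : i \in [set r x | x : G] -> part r i != set0.
Proof. by case/imsetP => x _ ->; apply/set0Pn; exists x; rewrite inE. Qed.

(* The good parts, whose cut is smaller than [delta], have more than [delta]
   vertices; the cut sizes add up to at most [2k(t-1) - 2], which leaves at least
   two parts with a cut below [2k], and at least four good parts if [t >= 4]. *)
Lemma sparse_partition k delta :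
  2 <= k -> 6 * k - 4 <= delta -> (forall x : G, delta <= #|[set y | adj x y]|) ->
  1 < #|G| -> tau G < k ->
  [\/ exists X : {set G}, [/\ delta < #|X|, #|X| <= #|~: X| & cut X < k],
      exists X Y : {set G}, [/\ [disjoint X & Y], delta < #|X|, #|X| <= #|Y| /\ #|X| <= #|~: (X :|: Y)|,
        [/\ cut X < 2 * k, cut Y < 2 * k & cut (~: (X :|: Y)) < 2 * k] &
        cut X + cut Y + cut (~: (X :|: Y)) <= 4 * k - 2] |
      exists X Y Z : {set G}, [/\ [disjoint X & Y], [disjoint X :|: Y & Z], delta < #|X| <= #|Y|,
        [/\ delta < #|Z|, delta < #|~: (X :|: Y :|: Z)| & cut Z < delta] &
        cut X < 2 * k /\ cut Y < 2 * k] ].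
Proof.
move=> k2 kd dG G1 tk.
case: (tree_packing_theorem k (ltnW G1) (@edges_pairs G)) => [[F [pF cF]]|[r [rr]]].
  by have := packing_tau G1 pF cF; rewrite leqNgt tk.
set I := [set r x | x : G]; rewrite -/(cross_edges r) => cross.
pose w i := cut (part r i).
have wc i : w i <= #|cross_edges r| := cut_part_le r i.
have sw : \sum_(i in I) w i <= 2 * #|cross_edges r| := sum_cut_part r.
have good i : i \in I -> w i < delta -> delta < #|part r i|.
  by move=> iI; apply: cut_small => //; apply: part_neq0.
have t2 : 1 < #|I| by move: cross; move: #|I| => t; nia.
have [i1 i1I min1] : exists2 i, i \in I & forall j, j \in I -> w i <= w j.
  have /card_gt0P[i0 i0I] : 0 < #|I| by apply: ltnW.
  by have [i iI h] := arg_minnP w i0I; exists i.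
have cI1 : #|I :\ i1| = #|I|.-1 by rewrite (cardsD1 i1 I) i1I.
have [i2 i2I min2] : exists2 i, i \in I :\ i1 & forall j, j \in I :\ i1 -> w i <= w j.
  have /card_gt0P[i0 i0I] : 0 < #|I :\ i1| by rewrite cI1; lia.
  by have [i iI h] := arg_minnP w i0I; exists i.
have [i21 i2I'] : i2 != i1 /\ i2 \in I by move: i2I; rewrite !inE => /andP.
(* Otherwise all parts but [i1] have a cut of at least [2k], and the cuts add up to at least
   [2k(t - 1)]. *)
have w2 : w i2 < 2 * k.
  rewrite ltnNge; apply/negP => h.
  have : \sum_(i in I :\ i1) 2 * k <= \sum_(i in I) w i.
    rewrite (bigD1 i1 i1I) /=; apply: leq_trans (leq_addl _ _).
    rewrite [X in _ <= X](eq_bigl [in I :\ i1]) => [|j]; last by rewrite !inE andbC.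
    by apply: leq_sum => i /min2; apply: leq_trans.
  rewrite sum_nat_const cI1; move: sw cross; move: (\sum_(i in I) w i) #|I| t2 #|cross_edges r|.
  by clear => S t t2 c; nia.
have w1 : w i1 < 2 * k by apply: leq_ltn_trans w2; apply: min1.
have d2 : 2 * k <= delta by lia.
have g1 := good _ i1I (leq_trans w1 d2); have g2 := good _ i2I' (leq_trans w2 d2).
have c12 i j : i != j -> [disjoint part r i & part r j] := @part_disjoint r i j.
have i12 : i1 != i2 by rewrite eq_sym.
have [tE|t3] := eqVneq #|I| 2.
  have cX : part r i2 = ~: part r i1.
    have IE : I = [set i1; i2].
      apply/eqP; rewrite eq_sym eqEcard subUset !sub1set i1I i2I' cards2 i12 tE.
      by [].
    apply/setP => x; rewrite !inE; have : r x \in I by apply: imset_f.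
    by rewrite IE !inE => /orP[]/eqP->; rewrite eqxx ?(negPf i12) // eq_sym (negPf i12).
  have wk i : w i < k by have := wc i; move: cross; rewrite tE; lia.
  apply: Or31; case: (leqP #|part r i1| #|part r i2|) => h.
    by exists (part r i1); rewrite -cX g1 h wk.
  by exists (part r i2); rewrite [in ~: _]cX setCK g2 (ltnW h) wk.
have [tE|t4] := eqVneq #|I| 3.
  have wk i : w i < 2 * k by have := wc i; move: cross; rewrite tE; lia.
  have [j1 j1I minj] : exists2 i, i \in I & forall j, j \in I -> #|part r i| <= #|part r j|.
    by have [i iI h] := arg_minnP (fun i => #|part r i|) i1I; exists i.
  have cJ1 : #|I :\ j1| = 2 by have := cardsD1 j1 I; rewrite j1I tE; lia.
  have /cards2P[j2 [j3 [j23 IE]]] : #|I :\ j1| == 2 by rewrite cJ1.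
  have [j21 j2I] : j2 != j1 /\ j2 \in I.
    by apply/andP; rewrite -in_setD1 IE set21.
  have [j31 j3I] : j3 != j1 /\ j3 \in I.
    by apply/andP; rewrite -in_setD1 IE set22.
  have cX : ~: (part r j1 :|: part r j2) = part r j3.
    apply/setP => x; rewrite !inE negb_or; have rI : r x \in I by apply: imset_f.
    have [->|xj1] := eqVneq (r x) j1; first by rewrite [in RHS]eq_sym (negPf j31).
    have : r x \in I :\ j1 by rewrite !inE xj1.
    by rewrite IE !inE => /orP[]/eqP->; rewrite eqxx ?(negPf j23) // eq_sym j23.
  apply: Or32; exists (part r j1), (part r j2); rewrite cX; split.
  - by apply: c12; rewrite eq_sym.
  - by apply: good => //; apply: leq_trans (wk _) d2.
  - by split; apply: minj.
  - by split; apply: wk.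
  - move: sw cross; rewrite (bigD1 j1 j1I) /= (eq_bigl [in I :\ j1]); last first.
      by move=> j; rewrite !inE andbC.
    rewrite IE big_setU1 ?inE // big_set1 tE /w /=; clear -k2; lia.
pose gd := [set i in I | w i < delta].
have g4 : 3 < #|gd|.
  rewrite ltnNge; apply/negP => gd3.
  have : \sum_(i in I :\: gd) delta <= \sum_(i in I) w i.
    rewrite [leqRHS](big_setID gd) /=; apply: leq_trans (leq_addl _ _).
    by apply: leq_sum => i; rewrite !inE => /andP[]; case: (i \in I) => //=; rewrite -leqNgt.
  have gI : gd \subset I by apply/fintype.subsetP => i; rewrite inE => /andP[].
  have := cardsID gd I; rewrite (finset.setIidPr gI) sum_nat_const.
  (* For [t = 4] the summation only yields [6k - 4 <= 6k - 2], which is no contradiction; but then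
     each cut is at most [3k - 1 < delta]. *)
  have : #|I| = 4 -> gd = I.
    move=> t4E; apply/setP => i; rewrite inE; case: (boolP (i \in I)) => //= iI.
    by apply: leq_trans (_ : (w i).+1 <= _) _ => //; have := wc i; move: cross; rewrite t4E; lia.
  move: sw cross t2 t3 t4 gd3 kd k2 d2; move: (\sum_(i in I) w i) => S.
  case: (eqVneq #|I| 4) => [t4E|t5].
    by move=> _ _ _ _ _ gd3 _ _ _ /(_ t4E) gdE; rewrite gdE t4E in gd3.
  move: #|cross_edges r| #|I| t5 #|gd| #|I :\: gd| => c t t5 g b.
  move=> sw cross t2 t3 t4 gd3 kd k2 d2 _ tE h.
  have : (t - 3) * (6 * k - 4) <= b * delta by apply: leq_mul; lia.
  have : exists t', t = t' + 5 by exists (t - 5); lia.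
  case=> t' t'E; subst t; nia.
have gdP i : i \in gd -> i \in I /\ w i < delta by rewrite inE => /andP.
have [i3 i3g] : exists i, i \in gd :\ i1 :\ i2.
  apply/card_gt0P; have := cardsD1 i2 (gd :\ i1); have := cardsD1 i1 gd.
  by do 2!case: (_ \in _); lia.
have [i4 i4g] : exists i, i \in gd :\ i1 :\ i2 :\ i3.
  apply/card_gt0P; have := cardsD1 i3 (gd :\ i1 :\ i2); have := cardsD1 i2 (gd :\ i1).
  by have := cardsD1 i1 gd; do 3!case: (_ \in _); clear -g4; lia.
have [i32 i31 /gdP[i3I w3]] : [/\ i3 != i2, i3 != i1 & i3 \in gd].
  by move: i3g; rewrite !in_setD1 => /and3P.
have [i43 i42 i41 /gdP[i4I w4]] : [/\ i4 != i3, i4 != i2, i4 != i1 & i4 \in gd].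
  by move: i4g; rewrite !in_setD1 => /and4P.
have dis a b j : [disjoint part r a & part r j] -> [disjoint part r b & part r j] ->
    [disjoint part r a :|: part r b & part r j].
  by rewrite -!setI_eq0 finset.setIUl => /eqP-> /eqP->; rewrite finset.setU0.
have big a b : part r i4 \subset ~: (part r a :|: part r b :|: part r i3) ->
    delta < #|~: (part r a :|: part r b :|: part r i3)|.
  by move/subset_leq_card; apply: leq_trans; apply: good.
have sub4 a b : i4 != a -> i4 != b ->
    part r i4 \subset ~: (part r a :|: part r b :|: part r i3).
  move=> x4 y4; apply/fintype.subsetP => x; rewrite !inE => /eqP->.
  by rewrite (negPf x4) (negPf y4) (negPf i43).
have g3 := good _ i3I w3.
apply: Or33; case: (leqP #|part r i1| #|part r i2|) => h.
  exists (part r i1), (part r i2), (part r i3); split=> //; try by rewrite g1.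
  - exact: c12.
  - by apply: dis; apply: c12; rewrite eq_sym.
  - by split=> //; apply/big/sub4.
exists (part r i2), (part r i1), (part r i3); split=> //; try by rewrite g2 ltnW.
- exact: c12.
- by apply: dis; apply: c12; rewrite eq_sym.
- by split=> //; apply/big/sub4.
Qed.
End Cuts.

Import Order.TTheory GRing.Theory Num.Theory.
Local Open Scope ring_scope.

(** * Rayleigh quotients and the distance form *)

Section Rayleigh.
Variable R : realType.

Definition bilin n (A : 'M[R]_n) (x y : 'rV[R]_n) : R := (x *m A *m y^T) 0 0.

Lemma bilinE n (A : 'M[R]_n) x y :
  bilin A x y = \sum_i \sum_j A i j * x 0 i * y 0 j.
Proof.
rewrite /bilin mxE; under eq_bigr do rewrite mxE mulr_suml.
rewrite exchange_big; apply: eq_bigr => i _; apply: eq_bigr => j _.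
by rewrite mxE; ring.
Qed.

Lemma bilin1E n (x y : 'rV[R]_n) : bilin 1%:M x y = \sum_i x 0 i * y 0 i.
Proof. by rewrite /bilin mulmx1 mxE; apply: eq_bigr => i _; rewrite mxE. Qed.

Lemma bilin1_ge0 n (x : 'rV[R]_n) : 0 <= bilin 1%:M x x.
Proof. by rewrite bilin1E sumr_ge0 // => i _; rewrite -expr2 sqr_ge0. Qed.

Lemma bilin1_gt0 n (x : 'rV[R]_n) : x != 0 -> 0 < bilin 1%:M x x.
Proof.
move=> x0; rewrite lt_neqAle bilin1_ge0 andbT eq_sym; apply: contra x0.
rewrite bilin1E psumr_eq0 => [|i _]; last by rewrite -expr2 sqr_ge0.
move=> /allP x0; apply/eqP/rowP => i; rewrite mxE.
by have /implyP/(_ isT) := x0 i (mem_index_enum _); rewrite -expr2 sqrf_eq0 => /eqP.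
Qed.

Lemma bilinDl n (A : 'M[R]_n) x y z : bilin A (x + y) z = bilin A x z + bilin A y z.
Proof. by rewrite /bilin !mulmxDl mxE. Qed.

Lemma bilinDr n (A : 'M[R]_n) x y z : bilin A z (x + y) = bilin A z x + bilin A z y.
Proof. by rewrite /bilin linearD mulmxDr mxE. Qed.

Lemma bilinZl n (A : 'M[R]_n) a x z : bilin A (a *: x) z = a * bilin A x z.
Proof. by rewrite /bilin -!scalemxAl mxE. Qed.

Lemma bilinZr n (A : 'M[R]_n) a x z : bilin A z (a *: x) = a * bilin A z x.
Proof. by rewrite /bilin linearZ /= -scalemxAr mxE. Qed.

Lemma bilin_sym n (A : 'M[R]_n) x y : A^T = A -> bilin A x y = bilin A y x.
Proof.
move=> AT; rewrite /bilin -[in LHS](trmxK (x *m A *m y^T)) [in LHS]mxE.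
by rewrite !trmx_mul trmxK AT mulmxA.
Qed.

Lemma bilin_bound n (A : 'M[R]_n) x :
  bilin A x x <= (\sum_i \sum_j `|A i j|) * bilin 1%:M x x.
Proof.
rewrite bilinE mulr_suml ler_sum // => i _; rewrite mulr_suml ler_sum // => j _.
have xx (l : 'I_n) : x 0 l ^+ 2 <= bilin 1%:M x x.
  rewrite bilin1E (bigD1 l) //= expr2 lerDl sumr_ge0 // => m _.
  by rewrite -expr2 sqr_ge0.
have xij : `|x 0 i * x 0 j| <= bilin 1%:M x x.
  have := xx i; have := xx j; rewrite -[_ ^+ 2]real_normK ?num_real //.
  rewrite -[x 0 i ^+ 2]real_normK ?num_real // normrM.
  have := sqr_ge0 (`|x 0 i| - `|x 0 j|); nra.
rewrite -mulrA (le_trans (ler_norm _)) // normrM.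
by rewrite ler_wpM2l.
Qed.

(** At [(c, -b)] the form is [c (a c - b^2)], at [(b, -a)] it is [a (a c - b^2)]; if [a = c = 0] it
    is [2 s t b], which changes sign unless [b = 0]. *)
Lemma disc_le0 (a b c : R) :
  (forall s t, 0 <= s ^+ 2 * a + 2 * s * t * b + t ^+ 2 * c) -> b ^+ 2 <= a * c.
Proof.
move=> h; have a0 := h 1 0; have c0 := h 0 1.
have h1 := h c (- b); have h2 := h b (- a).
have [c_gt0|c_le0] := ltP 0 c; first by nra.
have [a_gt0|a_le0] := ltP 0 a; first by nra.
have [? ?] : a = 0 /\ c = 0 by split; lra.
by subst; have := h 1 (- b); nra.
Qed.

Lemma bilin_cauchy_schwarz n (B : 'M[R]_n) : B^T = B ->
  (forall x, 0 <= bilin B x x) ->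
  forall x y, bilin B x y ^+ 2 <= bilin B x x * bilin B y y.
Proof.
move=> BT B0 x y; apply: disc_le0 => s t.
have := B0 (s *: x + t *: y).
rewrite !bilinDl !bilinDr !bilinZl !bilinZr (bilin_sym y x BT).
by congr (0 <= _); ring.
Qed.

Lemma bilinB n (l : R) (A : 'M[R]_n) x y :
  bilin (l%:M - A) x y = l * bilin 1%:M x y - bilin A x y.
Proof.
rewrite /bilin mulmxBr mul_mx_scalar mulmxBl mxE [X in _ + X]mxE mulmx1.
by rewrite -scalemxAl mxE.
Qed.

(* The supremum [m] of the Rayleigh quotients is attained: if [B = m - A] were
   invertible, Cauchy-Schwarz for [B] applied to [x] and [x B^-1] would bound all
   the quotients by [m - 1/c] for some [c > 0]. *)
Theorem rayleigh_max n (A : 'M[R]_n) : (0 < n)%N -> A^T = A ->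
  let l := largest_eigenvalue A in
  [/\ exists2 x : 'rV[R]_n, x != 0 & x *m A = l *: x,
      forall x, bilin A x x <= l * bilin 1%:M x x &
      forall x, bilin A x x = l * bilin 1%:M x x -> x *m A = l *: x].
Proof.
move=> n0 AT.
pose E (r : R) := exists2 x : 'rV[R]_n, x != 0 & r = bilin A x x / bilin 1%:M x x.
have ubE r : E r -> r <= \sum_i \sum_j `|A i j|.
  by case=> x x0 ->; rewrite ler_pdivrMr ?bilin1_gt0 // bilin_bound.
have E0 : classical_sets.nonempty E.
  pose j : 'rV[R]_n := const_mx 1.
  exists (bilin A j j / bilin 1%:M j j), j => //.
  apply/eqP => /rowP/(_ (Ordinal n0)); rewrite !mxE.
  by apply/eqP; rewrite oner_neq0.
have supE : classical_sets.has_sup E by split=> //; exists (\sum_i \sum_j `|A i j|); apply/classical_sets.ubP.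
pose m := sup E.
have ub x : bilin A x x <= m * bilin 1%:M x x.
  have [->|x0] := eqVneq x 0; first by rewrite /bilin !mul0mx mxE mulr0.
  rewrite -ler_pdivrMr ?bilin1_gt0 //.
  by apply: (ub_le_sup (proj2 supE)); exists x.
pose B := m%:M - A.
have BT : B^T = B by rewrite /B linearB /= tr_scalar_mx AT.
have B0 x : 0 <= bilin B x x by rewrite bilinB subr_ge0.
have CS := bilin_cauchy_schwarz BT B0.
have ker x : bilin A x x = m * bilin 1%:M x x -> x *m A = m *: x.
  move=> xx; have : bilin B x x = 0 by rewrite bilinB xx subrr.
  (* Cauchy-Schwarz for [x] and [x B]: the value [bilin B x (x *m B)] is the squared norm of
     [x B]. *)
  move=> Bx; have : bilin 1%:M (x *m B) (x *m B) = 0.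
    have : bilin B x (x *m B) = 0.
      by apply/eqP; rewrite -sqrf_eq0 eq_le sqr_ge0 andbT (le_trans (CS _ _)) // Bx mul0r.
    by rewrite /bilin mulmx1.
  move=> xB; have : x *m B = 0.
    by apply/eqP; apply: contra_eqT xB => /bilin1_gt0; rewrite lt0r => /andP[].
  by rewrite mulmxBr mul_mx_scalar => /eqP; rewrite subr_eq0 => /eqP.
have singB : B \notin unitmx.
  apply/negP => uB; pose c := 1 + \sum_i \sum_j `|invmx B i j|.
  have c_ge1 : 1 <= c by rewrite lerDl !sumr_ge0 // => i _; rewrite sumr_ge0.
  have cT : (invmx B)^T = invmx B by rewrite trmx_inv BT.
  have gap x : bilin 1%:M x x <= c * bilin B x x.
    have := CS x (x *m invmx B).
    have -> : bilin B x (x *m invmx B) = bilin 1%:M x x.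
      by rewrite /bilin trmx_mul cT mulmxA mulmxK // mulmx1.
    have -> : bilin B (x *m invmx B) (x *m invmx B) = bilin (invmx B) x x.
      by rewrite /bilin trmx_mul cT mulmxKV // mulmxA.
    have := bilin_bound (invmx B) x; have := bilin1_ge0 x; have := B0 x.
    have cE : \sum_i \sum_j `|invmx B i j| = c - 1 by rewrite /c; ring.
    rewrite cE; move: (bilin B x x) (bilin (invmx B) x x) (bilin 1%:M x x) => b i d b0 d0 ic h.
    have [d_gt0|d_le0] := ltP 0 d; last by nra.
    have : d * d <= d * (c * b) by nra.
    by rewrite ler_pM2l.
  have : m <= m - c^-1.
    apply: (ge_sup E0) => _ [x x0 ->]; rewrite ler_pdivrMr ?bilin1_gt0 //.
    have := gap x; rewrite bilinB.
    have c_gt0 : 0 < c by lra.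
    move=> h; have : c^-1 * bilin 1%:M x x <= m * bilin 1%:M x x - bilin A x x.
      by rewrite ler_pdivrMl.
    by rewrite mulrBl; lra.
  have : 0 < c^-1 by rewrite invr_gt0; lra.
  lra.
have [x x0 xA] : exists2 x : 'rV[R]_n, x != 0 & x *m A = m *: x.
  have : kermx B != 0.
    by rewrite kermx_eq0 row_free_unit.
  case/rowV0Pn => x /sub_kermxP xB x0; exists x => //.
  by move/eqP: xB; rewrite mulmxBr mul_mx_scalar subr_eq0 => /eqP.
have lm : largest_eigenvalue A = m.
  apply/eqP; rewrite eq_le; apply/andP; split.
    apply: ge_sup; first by exists m; apply/eigenvalueP; exists x.
    move=> r /eigenvalueP[y yA y0].
    have := ub y; rewrite /bilin yA mulmx1 -scalemxAl mxE.
    rewrite ler_pM2r //; have := bilin1_gt0 y0; by rewrite /bilin mulmx1.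
  apply: ub_le_sup; last by apply/eigenvalueP; exists x.
  exists m => r /eigenvalueP[y yA y0].
  have := ub y; rewrite /bilin yA mulmx1 -scalemxAl mxE.
  rewrite ler_pM2r //; have := bilin1_gt0 y0; by rewrite /bilin mulmx1.
by rewrite lm; split => //; exists x.
Qed.

End Rayleigh.

(** * The quadratic form of the distance matrix *)

Section DistanceForm.
Variables (R : realType) (G : sgraph).
Hypothesis G0 : (0 < #|G|)%N.

Local Notation d u v := ((dist (G := G) u v)%:R : R).
Local Notation rho := (distance_spectral_radius R G).

Lemma sum_enum_val (F : G -> R) : \sum_(i < #|G|) F (enum_val i) = \sum_u F u.
Proof. by rewrite [RHS](reindex _ (onW_bij _ (@enum_val_bij G))). Qed.

Lemma distance_matrix_sym : (distance_matrix R G)^T = distance_matrix R G.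
Proof. by apply/matrixP => i j; rewrite !mxE dist_sym. Qed.

Let row_of (x : G -> R) : 'rV[R]_#|G| := \row_i x (enum_val i).

Lemma distance_formE x :
  bilin (distance_matrix R G) (row_of x) (row_of x) = \sum_u \sum_v d u v * x u * x v.
Proof.
rewrite bilinE -sum_enum_val; apply: eq_bigr => i _.
rewrite -(sum_enum_val (fun v => d (enum_val i) v * x (enum_val i) * x v)).
by apply: eq_bigr => j _; rewrite !mxE.
Qed.

Lemma distance_norm2E x : bilin 1%:M (row_of x) (row_of x) = \sum_u x u ^+ 2.
Proof.
rewrite bilin1E -(sum_enum_val (fun u => x u ^+ 2)).
by apply: eq_bigr => i _; rewrite !mxE expr2.
Qed.

Lemma distance_form_le x :
  \sum_u \sum_v d u v * x u * x v <= rho * \sum_u x u ^+ 2.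
Proof.
have [_ h _] := rayleigh_max G0 distance_matrix_sym.
by rewrite -distance_formE -distance_norm2E.
Qed.

(** Distances are nonnegative, so replacing the entries of a maximal eigenvector by their absolute
    values does not decrease the form; the new vector attains the maximum and is again an
    eigenvector. *)
Lemma distance_perron : exists y : G -> R,
  [/\ forall u, 0 <= y u, exists u, 0 < y u &
      forall v, \sum_u d u v * y u = rho * y v].
Proof.
have [[x x0 xD] le eq] := rayleigh_max G0 distance_matrix_sym.
pose y u := `|x 0 (enum_rank u)|.
have xE : bilin 1%:M x x = \sum_u y u ^+ 2.
  rewrite bilin1E -(sum_enum_val (fun u => y u ^+ 2)); apply: eq_bigr => i _.
  by rewrite /y enum_valK real_normK ?num_real // expr2.
have yD : row_of y *m distance_matrix R G = rho *: row_of y.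
  apply: eq; apply/eqP; rewrite eq_le le /= distance_norm2E -xE.
  have -> : largest_eigenvalue (distance_matrix R G) * bilin 1%:M x x =
      bilin (distance_matrix R G) x x.
    by rewrite /bilin xD mulmx1 -scalemxAl [in RHS]mxE.
  rewrite !bilinE; apply: ler_sum => i _; apply: ler_sum => j _.
  rewrite -!mulrA; rewrite !mxE; apply: ler_wpM2l; first exact: ler0n.
  by rewrite /y !enum_valK -normrM ler_norm.
exists y; split; first by move=> u; rewrite normr_ge0.
  have /rV0Pn[i xi] := x0; exists (enum_val i).
  by rewrite /y enum_valK normr_gt0.
move=> v; have /rowP/(_ (enum_rank v)) := yD; rewrite !mxE enum_rankK => <-.
rewrite -sum_enum_val; apply: eq_bigr => i _; rewrite !mxE enum_rankK mulrC.
by [].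
Qed.

End DistanceForm.

(** * Distances and Perron vector of two cliques joined by a matching *)

Section TwoCliquesDistance.
Variables (R : realType) (n a s : nat).
Hypotheses (s0 : (0 < s)%N) (sa : (s < a)%N) (sb : (s < n - a)%N).

Local Notation M := (two_cliques n a s).
Local Notation d u v := ((dist (G := M) u v)%:R : R).

Lemma two_cliques_dist_inl (i j : 'I_a) : dist (G := M) (inl i) (inl j) = (i != j).
Proof.
have [->|ij] := eqVneq i j; first by rewrite distxx.
by rewrite dist1.
Qed.

Lemma two_cliques_dist_inr (i j : 'I_(n - a)) : dist (G := M) (inr i) (inr j) = (i != j).
Proof.
have [->|ij] := eqVneq i j; first by rewrite distxx.
by rewrite dist1.
Qed.

Lemma two_cliques_dist_cross (i : 'I_a) (j : 'I_(n - a)) :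
  dist (G := M) (inl i) (inr j) =
  if (i < s)%N || (j < s)%N then (if i == j :> nat then 1 else 2)%N else 3.
Proof.
have G2 : (2 < #|M|)%N by rewrite card_sum !card_ord; lia.
have nadj : ~~ ((i == j :> nat) && (i < s)%N) -> (2 <= dist (G := M) (inl i) (inr j))%N.
  by move=> ?; apply: dist_ge2.
case: ifP => [|/norP[si sj]].
  have [ij h|ij h] := eqVneq (i : nat) j.
    by rewrite dist1 //= ij eqxx; move: h; rewrite ij orbb.
  apply/eqP; rewrite eqn_leq nadj ?(negPf ij) // andbT.
  case/orP: h => h.
    have ib : (i < n - a)%N by apply: ltn_trans sb.
    apply: (@dist_le2 M _ (inr (Ordinal ib))) => /=; first by rewrite eqxx h.
    exact: ij.
  have ja : (j < a)%N by apply: ltn_trans sa.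
  apply: (@dist_le2 M _ (inl (Ordinal ja))) => /=; last by rewrite eqxx h.
  exact: ij.
have oa : (0 < a)%N by lia.
have ob : (0 < n - a)%N by lia.
apply/eqP; rewrite eqn_leq; apply/andP; split.
  apply: (@dist_le3 M _ (inl (Ordinal oa)) (inr (Ordinal ob))) => /=.
  - by rewrite -val_eqE /=; lia.
  - exact: s0.
  - by rewrite -val_eqE /=; lia.
apply: dist_ge3 => //=; first by rewrite (negPf si) andbF.
case=> l /=; last by rewrite (negPf si) andbF.
by move=> _; apply: contra sj => /andP[/eqP<-].
Qed.

Lemma sum_threshold m (al be : R) : (s <= m)%N ->
  \sum_(j < m) (if (j < s)%N then al else be) = s%:R * al + (m - s)%:R * be.
Proof.
move=> sm; rewrite -(big_mkord xpredT (fun j => if (j < s)%N then al else be)).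
rewrite (big_cat_nat (n := s)) //=; congr (_ + _).
  rewrite (eq_big_nat _ _ (F2 := fun=> al)) => [|j /andP[_ ->]] //.
  by rewrite sumr_const_nat subn0 mulr_natl.
rewrite (eq_big_nat _ _ (F2 := fun=> be)) => [|j /andP[sj _]].
  by rewrite sumr_const_nat mulr_natl.
by rewrite ltnNge sj.
Qed.

Lemma sum_threshold_except m (i : 'I_m) (al be : R) : (s <= m)%N ->
  \sum_(j < m) (j != i)%:R * (if (j < s)%N then al else be) =
  s%:R * al + (m - s)%:R * be - (if (i < s)%N then al else be).
Proof.
move=> sm; rewrite -sum_threshold // [X in _ = X - _](bigD1 i) //= addrAC subrr add0r.
rewrite (bigD1 i) //= eqxx mul0r add0r; apply: eq_bigr => j ji.
by rewrite ji mul1r.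
Qed.

Let p : R := (a - s)%:R.
Let q : R := (n - a - s)%:R.
Let sr : R := s%:R.

(** [P] and [Q] stand for the unmatched vertices of the first and the second clique, [S] and [T] for
    the matched ones. *)
Definition class_fun (zP zS zT zQ : R) (v : M) : R :=
  match v with
  | inl i => if (i < s)%N then zS else zP
  | inr j => if (j < s)%N then zT else zQ
  end.

(** The coefficients form the quotient matrix of an equitable partition. A matched vertex has its
    mate at distance 1 and the other [s - 1] matched vertices across at distance 2, hence
    [2 * sr - 1]. *)
Lemma class_fun_dist zP zS zT zQ v :
  \sum_u d u v * class_fun zP zS zT zQ u =
  class_fun ((p - 1) * zP + sr * zS + 2 * sr * zT + 3 * q * zQ)
            (p * zP + (sr - 1) * zS + (2 * sr - 1) * zT + 2 * q * zQ)
            (2 * p * zP + (2 * sr - 1) * zS + (sr - 1) * zT + q * zQ)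
            (3 * p * zP + 2 * sr * zS + sr * zT + (q - 1) * zQ) v.
Proof.
have nat_if (b : bool) (x y : nat) : (if b then x else y)%:R = if b then x%:R else y%:R :> R.
  by case: b.
have sal := ltnW sa; have sbl := ltnW sb.
rewrite big_sumType /=; case: v => [i|j] /=.
  have -> : \sum_(i' < a) d (inl i') (inl i) * (if (i' < s)%N then zS else zP) =
      sr * zS + p * zP - (if (i < s)%N then zS else zP).
    rewrite -sum_threshold_except //; apply: eq_bigr => l _.
    by rewrite two_cliques_dist_inl.
  under [X in _ + X]eq_bigr => j _ do rewrite dist_sym two_cliques_dist_cross.
  case: ifP => si /=.
    have ib : (i < n - a)%N by apply: ltn_trans sb.
    have -> : \sum_(j < n - a) (if i == j :> nat then 1 else 2)%N%:R *
        (if (j < s)%N then zT else zQ) = 2 * (sr * zT + q * zQ) - zT.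
      rewrite -sum_threshold // mulr_sumr (bigD1 (Ordinal ib)) //= [in RHS](bigD1 (Ordinal ib)) //=.
      rewrite eqxx si mul1r [in RHS]addrAC; congr (_ + _); first by ring.
      apply: eq_bigr => j; rewrite -val_eqE /= eq_sym => /negPf->; by [].
    by ring.
  have -> : \sum_(j < n - a) (if (j < s)%N then (if i == j :> nat then 1 else 2)%N else 3)%:R *
      (if (j < s)%N then zT else zQ) = sr * (2 * zT) + q * (3 * zQ).
    rewrite -sum_threshold //; apply: eq_bigr => j _; case: ifP => sj //.
    by case: eqP => // e; rewrite e sj in si.
  by ring.
have -> : \sum_(i < n - a) d (inr i) (inr j) * (if (i < s)%N then zT else zQ) =
    sr * zT + q * zQ - (if (j < s)%N then zT else zQ).
  rewrite -sum_threshold_except //; apply: eq_bigr => l _.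
  by rewrite two_cliques_dist_inr.
under eq_bigr => i _ do rewrite two_cliques_dist_cross.
case: ifP => sj /=.
  have ja : (j < a)%N by apply: ltn_trans sa.
  under eq_bigr => i _ do rewrite orbT.
  have -> : \sum_(i < a) (if i == j :> nat then 1 else 2)%N%:R *
      (if (i < s)%N then zS else zP) = 2 * (sr * zS + p * zP) - zS.
    rewrite -sum_threshold // mulr_sumr (bigD1 (Ordinal ja)) //= [in RHS](bigD1 (Ordinal ja)) //=.
    rewrite eqxx sj mul1r [in RHS]addrAC; congr (_ + _); first by ring.
    by apply: eq_bigr => i; rewrite -val_eqE /= => /negPf->.
  by ring.
have -> : \sum_(i < a) (if (i < s)%N || false then (if i == j :> nat then 1 else 2)%N else 3)%:R *
    (if (i < s)%N then zS else zP) = sr * (2 * zS) + p * (3 * zP).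
  rewrite -sum_threshold //; apply: eq_bigr => i _; rewrite orbF; case: ifP => si //.
  by case: eqP => // e; rewrite -e si in sj.
by ring.
Qed.

Local Notation l := (distance_spectral_radius R M).

(* Averaging a Perron eigenvector over the classes of the equitable partition
   gives a Perron eigenvector that is constant on them. *)
Lemma two_cliques_perron : exists xP xS xT xQ : R,
  [/\ 0 < xP, 0 < xS, 0 < xT & 0 < xQ] /\
  [/\ l * xP = (p - 1) * xP + sr * xS + 2 * sr * xT + 3 * q * xQ,
      l * xS = p * xP + (sr - 1) * xS + (2 * sr - 1) * xT + 2 * q * xQ,
      l * xT = 2 * p * xP + (2 * sr - 1) * xS + (sr - 1) * xT + q * xQ &
      l * xQ = 3 * p * xP + 2 * sr * xS + sr * xT + (q - 1) * xQ].
Proof.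
have M0 : (0 < #|M|)%N by rewrite card_sum !card_ord; lia.
have [y [y0 [w yw] yD]] := distance_perron R M0.
have p_gt0 : 1 <= p by rewrite /p ler1n; lia.
have q_gt0 : 1 <= q by rewrite /q ler1n; lia.
have s_gt0 : 1 <= sr by rewrite /sr ler1n.
pose Y (z : M -> R) := \sum_v y v * z v.
pose YP := Y (class_fun 1 0 0 0); pose YS := Y (class_fun 0 1 0 0).
pose YT := Y (class_fun 0 0 1 0); pose YQ := Y (class_fun 0 0 0 1).
have YE zP zS zT zQ : Y (class_fun zP zS zT zQ) = zP * YP + zS * YS + zT * YT + zQ * YQ.
  rewrite /YP /YS /YT /YQ /Y !mulr_sumr -!big_split /=; apply: eq_bigr => v _.
  by case: v => i /=; case: ifP => _; ring.
(* [Y] is the pairing with the eigenvector [y]; by symmetry the distance matrix can be moved to the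
   other factor. *)
have YD zP zS zT zQ : l * Y (class_fun zP zS zT zQ) =
    \sum_v y v * (\sum_u d u v * class_fun zP zS zT zQ u).
  rewrite /Y mulr_sumr; under eq_bigr do rewrite mulrA -yD mulr_suml.
  rewrite exchange_big /=; apply: eq_bigr => v _; rewrite mulr_sumr; apply: eq_bigr => u _.
  by rewrite dist_sym; ring.
have YDE zP zS zT zQ : l * Y (class_fun zP zS zT zQ) =
    Y (class_fun ((p - 1) * zP + sr * zS + 2 * sr * zT + 3 * q * zQ)
        (p * zP + (sr - 1) * zS + (2 * sr - 1) * zT + 2 * q * zQ)
        (2 * p * zP + (2 * sr - 1) * zS + (sr - 1) * zT + q * zQ)
        (3 * p * zP + 2 * sr * zS + sr * zT + (q - 1) * zQ)).
  by rewrite YD; apply: eq_bigr => v _; rewrite class_fun_dist.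
have eP := YDE 1 0 0 0; have eS := YDE 0 1 0 0; have eT := YDE 0 0 1 0.
have eQ := YDE 0 0 0 1; rewrite !YE in eP eS eT eQ.
have Y0 z : (forall v, 0 <= z v) -> 0 <= Y z.
  by move=> z0; apply: sumr_ge0 => v _; rewrite mulr_ge0.
have YP0 : 0 <= YP by apply: Y0 => -[] i /=; case: ifP.
have YS0 : 0 <= YS by apply: Y0 => -[] i /=; case: ifP.
have YT0 : 0 <= YT by apply: Y0 => -[] i /=; case: ifP.
have YQ0 : 0 <= YQ by apply: Y0 => -[] i /=; case: ifP.
have tot : 0 < YP + YS + YT + YQ.
  have -> : YP + YS + YT + YQ = Y (class_fun 1 1 1 1) by rewrite YE; ring.
  rewrite /Y (bigD1 w) //=; apply: ltr_pwDl.
    by rewrite (_ : class_fun 1 1 1 1 w = 1) ?mulr1 //; case: (w) => i /=; case: ifP.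
  by apply: sumr_ge0 => v _; rewrite mulr_ge0 //; case: (v) => i /=; case: ifP.
(* If one class sum vanished, its eigenvalue equation would force the other nonnegative sums to
   vanish as well. *)
have pos (Z Z1 Z2 Z3 c c1 c2 c3 : R) : 0 <= Z -> 0 <= Z1 -> 0 <= Z2 -> 0 <= Z3 ->
    1 <= c1 -> 1 <= c2 -> 1 <= c3 -> 0 < Z + Z1 + Z2 + Z3 ->
    l * Z = c * Z + c1 * Z1 + c2 * Z2 + c3 * Z3 -> 0 < Z.
  rewrite le_eqVlt => /orP[/eqP<-|//]; rewrite !mulr0 !add0r; nra.
have P_gt0 : 0 < YP.
  apply: (pos YP YS YT YQ (p - 1) p (2 * p) (3 * p)); rewrite //; lra.
have S_gt0 : 0 < YS.
  apply: (pos YS YP YT YQ (sr - 1) sr (2 * sr - 1) (2 * sr)); rewrite //; lra.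
have T_gt0 : 0 < YT.
  apply: (pos YT YP YS YQ (sr - 1) (2 * sr) (2 * sr - 1) sr); rewrite //; lra.
have Q_gt0 : 0 < YQ.
  apply: (pos YQ YP YS YT (q - 1) (3 * q) (2 * q) q); rewrite //; lra.
have p1 : 0 < p by lra. have q1 : 0 < q by lra. have s1 : 0 < sr by lra.
(* The class sums satisfy the transposed equations; division by the class sizes gives the equations
   for the averages. *)
exists (YP / p), (YS / sr), (YT / sr), (YQ / q).
split; first by rewrite !divr_gt0.
have np : p != 0 by rewrite gt_eqF. have nq : q != 0 by rewrite gt_eqF.
have ns : sr != 0 by rewrite gt_eqF.
split.
- apply: (mulfI np); rewrite (_ : p * (l * (YP / p)) = l * YP); last by field.
  rewrite (_ : l * YP = (p - 1) * YP + p * YS + 2 * p * YT + 3 * p * YQ); last lra.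
  by field; rewrite ?np ?nq ?ns.
- apply: (mulfI ns); rewrite (_ : sr * (l * (YS / sr)) = l * YS); last by field.
  rewrite (_ : l * YS = sr * YP + (sr - 1) * YS + (2 * sr - 1) * YT + 2 * sr * YQ); last lra.
  by field; rewrite ?np ?nq ?ns.
- apply: (mulfI ns); rewrite (_ : sr * (l * (YT / sr)) = l * YT); last by field.
  rewrite (_ : l * YT = 2 * sr * YP + (2 * sr - 1) * YS + (sr - 1) * YT + sr * YQ); last lra.
  by field; rewrite ?np ?nq ?ns.
- apply: (mulfI nq); rewrite (_ : q * (l * (YQ / q)) = l * YQ); last by field.
  rewrite (_ : l * YQ = 3 * q * YP + 2 * q * YS + q * YT + (q - 1) * YQ); last lra.
  by field; rewrite ?np ?nq ?ns.
Qed.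

End TwoCliquesDistance.

(** * Lower bounds for distances from a partition into classes *)

Section ClassifiedForm.
Variables (R : realType) (G : sgraph) (I : finType) (cl : G -> I).
Implicit Types (x : G -> R).

Definition class_sum x (i : I) : R := \sum_(u | cl u == i) x u.

(* A pair of vertices in different classes is at distance at least 3, minus one
   for each of the two vertices that has a neighbour in another class. *)
Definition base_dist (bd : G -> bool) (u v : G) : R :=
  (u != v)%:R + (cl u != cl v)%:R * (2 - (bd u)%:R - (bd v)%:R).

Lemma base_dist_le (bd : G -> bool) u v : (2 < #|G|)%N ->
  (forall u v, adj u v -> cl u != cl v -> bd u) -> base_dist bd u v <= (dist u v)%:R.
Proof.
move=> G2 hbd; rewrite /base_dist.
have [->|uv] := eqVneq u v; first by rewrite eqxx distxx mul0r addr0.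
have [cuv|cuv] := eqVneq (cl u) (cl v).
  by rewrite mul0r addr0 ler1n dist_ge1.
have [uva|nuv] := boolP (adj u v).
  have bu := hbd u v uva cuv; have bv : bd v.
    by apply: (hbd v u); rewrite 1?adj_sym // eq_sym.
  by rewrite dist1 // bu bv /=; lra.
have d2 : 2 <= (dist u v)%:R :> R by rewrite ler_nat dist_ge2.
case: (boolP (bd u)) => bu /=; first by have := ler0n R (bd v); lra.
case: (boolP (bd v)) => bv /=; first by lra.
have : 3 <= (dist u v)%:R :> R; last by lra.
rewrite ler_nat dist_ge3 // => z uz; apply/negP => zv.
have cz : cl u = cl z by apply/eqP; apply: contraNT bu; apply: hbd uz.
have /negP := bv; apply; apply: (hbd v z); first by rewrite adj_sym.
by rewrite -cz eq_sym.
Qed.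

Lemma sum_same x : \sum_u \sum_v (cl u == cl v)%:R * x u * x v = \sum_i class_sum x i ^+ 2.
Proof.
rewrite (partition_big cl xpredT) //=; apply: eq_bigr => i _.
rewrite expr2 /class_sum mulr_suml; apply: eq_bigr => u /eqP ui.
rewrite mulr_sumr [RHS]big_mkcond /=; apply: eq_bigr => v _.
by rewrite ui eq_sym; case: eqP; rewrite ?mul1r ?mul0r.
Qed.

(** The pairs [u != v] give [T ^+ 2] minus the squared norm; the pairs in different classes give
    twice [T ^+ 2] minus twice the squared class sums; the two boundary terms agree by symmetry. *)
Lemma sum_base_dist bd x (T := \sum_u x u) :
  \sum_u \sum_v base_dist bd u v * x u * x v =
  3 * T ^+ 2 - \sum_u x u ^+ 2 - 2 * \sum_i class_sum x i ^+ 2 -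
  2 * \sum_u (bd u)%:R * x u * (T - class_sum x (cl u)).
Proof.
have TT : \sum_u \sum_v x u * x v = T ^+ 2.
  by rewrite expr2 {1}/T mulr_suml; apply: eq_bigr => u _; rewrite mulr_sumr.
have NN : \sum_u \sum_v (u == v)%:R * x u * x v = \sum_u x u ^+ 2.
  apply: eq_bigr => u _; rewrite (bigD1 u) //= eqxx mul1r -expr2 big1 ?addr0 // => v.
  by rewrite eq_sym => /negPf->; rewrite !mul0r.
have BB : \sum_u \sum_v (cl u != cl v)%:R * (bd u)%:R * x u * x v =
    \sum_u (bd u)%:R * x u * (T - class_sum x (cl u)).
  apply: eq_bigr => u _.
  have -> : T = class_sum x (cl u) + \sum_(v | cl v != cl u) x v.
    by rewrite /T (bigID (fun v => cl v == cl u)).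
  rewrite addrAC subrr add0r mulr_sumr [RHS]big_mkcond /=; apply: eq_bigr => v _.
  by rewrite eq_sym; case: (cl v == cl u); rewrite ?mul0r // mul1r.
have BB' : \sum_u \sum_v (cl u != cl v)%:R * (bd v)%:R * x u * x v =
    \sum_u (bd u)%:R * x u * (T - class_sum x (cl u)).
  rewrite -BB exchange_big /=; apply: eq_bigr => u _; apply: eq_bigr => v _.
  by rewrite eq_sym; ring.
rewrite [X in _ - X]mulr_natl mulr2n opprD addrA -[X in _ - X - _]BB -BB' -NN -sum_same -TT.
rewrite !pair_bigA /= !mulr_sumr -!sumrB; apply: eq_bigr => -[u v] _ /=.
by rewrite /base_dist; case: eqP => _; case: eqP => _ /=; ring.
Qed.

End ClassifiedForm.

(** With all distances between the cliques raised to 3, the vector [(r, 1)] has eigenvalue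
    [3 a r + (n - a) - 1] by the equation in the second clique; the equation in the first clique is
    the quadratic one. Pairing it with the positive eigenvector of the graph compares the
    eigenvalues. *)
Lemma two_cliques_radius_le (R : realType) (n a s : nat) (r : R) :
  (0 < s)%N -> (s < a)%N -> (s < n - a)%N -> 0 < r ->
  3 * a%:R * r ^+ 2 + ((n - a)%:R - a%:R) * r = 3 * (n - a)%:R ->
  distance_spectral_radius R (two_cliques n a s) + 1 <= 3 * a%:R * r + (n - a)%:R.
Proof.
move=> s0 sa sb r0; have := two_cliques_perron R s0 sa sb.
set l := distance_spectral_radius _ _.
have -> : a%:R = (a - s)%:R + s%:R :> R by rewrite -natrD subnK // ltnW.
have -> : (n - a)%:R = (n - a - s)%:R + s%:R :> R by rewrite -natrD subnK // ltnW.
have p0 : 0 < (a - s)%:R :> R by rewrite ltr0n subn_gt0.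
have q0 : 0 < (n - a - s)%:R :> R by rewrite ltr0n subn_gt0.
have sr0 : 0 < s%:R :> R by rewrite ltr0n.
move: (a - s)%:R (n - a - s)%:R s%:R p0 q0 sr0 => p q t p0 q0 t0.
move=> [xP [xS [xT [xQ [[xP0 xS0 xT0 xQ0] [eP eS eT eQ]]]]]] er.
pose X1 := p * xP + t * xS; pose X2 := t * xT + q * xQ.
have X10 : 0 < X1 by rewrite addr_gt0 // mulr_gt0.
have X20 : 0 < X2 by rewrite addr_gt0 // mulr_gt0.
have Z0 : 0 < r * X1 + X2 by rewrite addr_gt0 // mulr_gt0.
rewrite -(ler_pM2r Z0).
have er' : X1 * (3 * (p + t) * r ^+ 2 + ((q + t) - (p + t)) * r) = X1 * (3 * (q + t)).
  by rewrite er.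
(* The effect of the distances below 3: a deficit of 1 for pairs with exactly one matched vertex,
   and a total deficit of [t (t - 1) + 2 t] for pairs of matched vertices. *)
have d0 : 0 <= p * t * (r * xT + xP) + t * q * (r * xQ + xS) + t * (t + 1) * (r * xT + xS).
  by rewrite !addr_ge0 // !mulr_ge0 ?addr_ge0 ?mulr_ge0 //; lra.
have lE : l * (r * X1 + X2) = r * p * (l * xP) + r * t * (l * xS) + t * (l * xT) + q * (l * xQ).
  by rewrite /X1 /X2; ring.
rewrite eP eS eT eQ in lE; rewrite mulrDl lE; move: er' d0; rewrite /X1 /X2; lra.
Qed.

(** * Partitions into three or more parts *)

Section Estimates.
Variable R : realFieldType.
Implicit Types a b r m y z : R.

(** Polynomial substitutes for the irrational [r]. The third bound is the chord from [b = 2a] to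
    [b = 12a] of what the second one gives; beyond [12a] the bound [r <= 3] takes over. *)
Lemma quadratic_root_bounds a b r : 0 < a -> 2 * a <= b -> 0 < r ->
  3 * a * r ^+ 2 + (b - a) * r = 3 * b ->
  [/\ 1 <= r, 6 * a * (r - 1) <= b & 3 * (a * r * b) <= 10 * a * b - 12 * a ^+ 2].
Proof.
move=> a0 ab r0 er.
have r1 : 1 <= r.
  rewrite leNgt; apply/negP => r1.
  have : a * r ^+ 2 < a by rewrite -subr_gt0 (_ : a - _ = a * (1 - r) * (1 + r)) ?mulr_gt0 //; [lra | lra | ring].
  have : (b - a) * r <= (b - a) by nra.
  lra.
have r3 : r <= 3.
  rewrite leNgt; apply/negP => r3.
  have : (b - a) * 3 <= (b - a) * r by nra.
  have : a * 9 <= a * r ^+ 2 by rewrite ler_pM2l //; nra.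
  lra.
have rb : 6 * a * (r - 1) <= b.
  rewrite leNgt; apply/negP => h.
  have [c rE] : exists c, r = c + 1 by exists (r - 1); ring.
  subst r; rewrite addrK in h; have c0 : 0 <= c by lra.
  (* The defining equation reads [b (2 - c) = a (3 c^2 + 5 c + 2)], where [r = c + 1]. *)
  have eb : b * (2 - c) = a * (3 * c ^+ 2 + 5 * c + 2).
    apply/eqP; rewrite -subr_eq0 (_ : _ - _ = 3 * b - (3 * a * (c + 1) ^+ 2 + (b - a) * (c + 1))).
      by rewrite er subrr.
    ring.
  have c2 : c <= 2 by lra.
  have h1 : b * (2 - c) <= 6 * a * c * (2 - c) by apply: ler_wpM2r; lra.
  (* [eb] and [h1] give [9 c^2 - 7 c + 2 <= 0], which has no real solution. *)
  have : 0 <= a * (3 * c - 1) ^+ 2 by rewrite mulr_ge0 ?sqr_ge0 // ltW.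
  nra.
split=> //.
have [b12|b12] := leP b (12 * a); last first.
  have : a * b * r <= a * b * 3 by apply: ler_wpM2l => //; apply: mulr_ge0; lra.
  have : a * (12 * a) <= a * b by apply: ler_wpM2l; lra.
  lra.
have h1 : 6 * a * (r - 1) * b <= b * b by apply: ler_wpM2r; lra.
have h2 : 0 <= (b - 2 * a) * (12 * a - b) by apply: mulr_ge0; lra.
lra.
Qed.

(** Half the comparison of distance forms. Here [a] and [m] count the vertices of [X] with value [r]
    and 1, [y] and [z] those of the other parts, and [c1], [c2], [c3] are the cuts; the left side
    bounds the loss at cut edges. On the right, the other parts are 3 apart instead of 1, and the
    [m] vertices are farther from them but nearer to the [a] vertices than in [M]. *)
Lemma three_parts_estimate a r m y z c1 c2 c3 (b := m + y + z) :
  0 < a -> 1 <= r -> 6 * a * (r - 1) <= b ->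
  3 * (a * r * b) <= 10 * a * b - 12 * a ^+ 2 ->
  0 <= m -> a + m <= y -> a + m <= z ->
  0 <= c1 -> 0 <= c2 -> 0 <= c3 -> 3 * c1 <= a -> 3 * (c1 + c2 + c3) <= 2 * a ->
  c1 * (r * (y + z)) + c2 * (a * r + m + z) + c3 * (a * r + m + y) <
  2 * y * z + 2 * m * (y + z - a * r).
Proof.
move=> a0 r1 rb arb m0 ym zm c10 c20 c30 c1a ca.
wlog yz : y z c2 c3 @b rb arb ym zm c20 c30 ca / y <= z => [h|].
  have [yz|/ltW zy] := leP y z; first exact: h.
  rewrite (addrC y z) addrAC (_ : 2 * y * z = 2 * z * y); last by ring.
  by apply: h => //; move: rb arb; rewrite /b; lra.
pose W := a * r + m + z.
have zW : a * r + m + y <= W by rewrite /W; lra.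
have W0 : 0 <= W by rewrite /W !addr_ge0 // ?mulr_ge0 //; lra.
have WC : W <= r * (y + z) by rewrite /W; nra.
have L1 : c1 * (r * (y + z)) + c2 * W + c3 * (a * r + m + y) <= c1 * (r * (y + z)) + (c2 + c3) * W.
  by have : c3 * (a * r + m + y) <= c3 * W by [apply: ler_wpM2l]; lra.
(* Since [W <= r * (y + z)], the worst case is [c1 = a / 3] and [c2 + c3 = a / 3]. *)
have L2 : 3 * (c1 * (r * (y + z)) + (c2 + c3) * W) <= a * (r * (y + z)) + a * W.
  have : 3 * (c2 + c3) * W <= (2 * a - 3 * c1) * W by apply: ler_wpM2r => //; lra.
  have : (3 * c1) * (r * (y + z) - W) <= a * (r * (y + z) - W) by apply: ler_wpM2r => //; lra.
  lra.
(* With nonnegative slacks the goal becomes linear in products of nonnegative quantities. *)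
pose y' := y - a - m; pose z' := z - y.
have yE : y = a + m + y' by rewrite /y'; ring.
have zE : z = a + m + y' + z' by rewrite /y' /z'; ring.
have y'0 : 0 <= y' by rewrite /y'; lra.
have z'0 : 0 <= z' by rewrite /z'; lra.
have arm : 6 * (a * r) * m <= (6 * a + b) * m by apply: ler_wpM2r => //; lra.
have ara : 6 * (a * r) * a <= (6 * a + b) * a by apply: ler_wpM2r => //; lra.
have ary : a * (r * (y + z)) <= a * r * b.
  rewrite -mulrA; apply: ler_wpM2l; first lra.
  by apply: ler_wpM2l; rewrite /b; lra.
have aa : 0 < a * a by apply: mulr_gt0.
have := mulr_ge0 m0 m0; have := mulr_ge0 (ltW a0) m0; have := mulr_ge0 (ltW a0) y'0.
have := mulr_ge0 (ltW a0) z'0; have := mulr_ge0 m0 y'0; have := mulr_ge0 m0 z'0.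
have := mulr_ge0 y'0 y'0; have := mulr_ge0 y'0 z'0.
move: arb arm ara ary L1 L2; rewrite /b /W; rewrite zE yE; lra.
Qed.

(** The third class now contains two large sets, and its cut is only bounded by the sum of the other
    two, hence [2 * a]. In exchange, of the at least [a (z - a)] pairs between these sets all but at
    most [a] are nonadjacent, which is the last summand. *)
Lemma four_parts_estimate a r m y z c1 c2 c3 (b := m + y + z) :
  9 <= a -> 1 <= r -> 6 * a * (r - 1) <= b ->
  3 * (a * r * b) <= 10 * a * b - 12 * a ^+ 2 ->
  0 <= m -> a + m <= y -> 2 * a <= z ->
  0 <= c1 -> 0 <= c2 -> 0 <= c3 -> 3 * c1 <= a -> 3 * c2 <= a -> 3 * c3 <= 2 * a ->
  c1 * (r * (y + z)) + c2 * (a * r + m + z) + c3 * (a * r + m + y) <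
  2 * y * z + 2 * m * (y + z - a * r) + (a * (z - a) - a).
Proof.
move=> a9 r1 rb arb m0 ym za c10 c20 c30 c1a c2a c3a.
have a0 : 0 < a by lra.
have L1 : 3 * c1 * (r * (y + z)) <= a * (r * (y + z)).
  by apply: ler_wpM2r => //; apply: mulr_ge0; lra.
have L2 : 3 * c2 * (a * r + m + z) <= a * (a * r + m + z).
  by apply: ler_wpM2r => //; rewrite !addr_ge0 ?mulr_ge0 //; lra.
have L3 : 3 * c3 * (a * r + m + y) <= 2 * a * (a * r + m + y).
  by apply: ler_wpM2r => //; rewrite !addr_ge0 ?mulr_ge0 //; lra.
pose y' := y - a - m; pose z' := z - 2 * a.
have yE : y = a + m + y' by rewrite /y'; ring.
have zE : z = 2 * a + z' by rewrite /z'; ring.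
have y'0 : 0 <= y' by rewrite /y'; lra.
have z'0 : 0 <= z' by rewrite /z'; lra.
have arm : 6 * (a * r) * m <= (6 * a + b) * m by apply: ler_wpM2r => //; lra.
have ara : 6 * (a * r) * a <= (6 * a + b) * a by apply: ler_wpM2r => //; lra.
have ary : a * (r * (y + z)) <= a * r * b - a * m.
  have : a * m <= a * (r * m) by apply: ler_wpM2l; nra.
  by rewrite /b; lra.
have aa : 9 * a <= a * a by apply: ler_wpM2r; lra.
have := mulr_ge0 m0 m0; have := mulr_ge0 (ltW a0) m0; have := mulr_ge0 (ltW a0) y'0.
have := mulr_ge0 (ltW a0) z'0; have := mulr_ge0 m0 y'0; have := mulr_ge0 m0 z'0.
have := mulr_ge0 y'0 y'0; have := mulr_ge0 y'0 z'0.
move: arb arm ara ary L1 L2 L3; rewrite /b zE yE; lra.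
Qed.

End Estimates.

(** * A two-valued test vector on three classes *)

Section ThreeClasses.
Variables (R : realType) (G : sgraph) (X Y A : {set G}) (r : R).
Hypotheses (XY : [disjoint X & Y]) (AX : A \subset X) (r1 : 1 <= r).

Local Notation Z := (~: (X :|: Y)).

Definition class3 (u : G) : option bool :=
  if u \in X then Some true else if u \in Y then Some false else None.

Definition boundary (I : finType) (cl : G -> I) (u : G) : bool :=
  [exists v, adj u v && (cl u != cl v)].

Definition two_values (u : G) : R := if u \in A then r else 1.

Local Notation x := two_values.
Local Notation bd := (boundary class3).

Lemma sum_boundary_le (I : finType) (cl : G -> I) i :
  \sum_(u | cl u == i) (boundary cl u)%:R <= (cut [set u | cl u == i])%:R :> R.
Proof.
rewrite -natr_sum ler_nat.
apply: leq_trans (leq_imset_card fst [in [set a : G * G | [&& adj a.1 a.2,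
  a.1 \in [set u | cl u == i] & a.2 \notin [set u | cl u == i]]]]).
rewrite (eq_bigr (fun u => if boundary cl u then 1%N else 0%N)); last by move=> u _; case: ifP.
rewrite -big_mkcondr sum1_card; apply/subset_leq_card/fintype.subsetP => u.
rewrite unfold_in => /andP[/eqP ui /existsP[v /andP[uv cuv]]].
by apply/imsetP; exists (u, v); rewrite // !inE /= uv ui eqxx -ui eq_sym cuv.
Qed.

Lemma class3_X : [set u | class3 u == Some true] = X.
Proof. by apply/setP => u; rewrite inE /class3; case: (u \in X); case: (u \in Y). Qed.

Lemma class3_Y : [set u | class3 u == Some false] = Y.
Proof.
apply/setP => u; rewrite inE /class3; case: (boolP (u \in X)) => uX.
  by have /negPf-> := disjointFr XY uX.
by case: (u \in Y).
Qed.

Lemma class3_Z : [set u | class3 u == None] = Z.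
Proof.
by apply/setP => u; rewrite !inE /class3; case: (u \in X); case: (u \in Y).
Qed.

Lemma sum_option_bool (F : option bool -> R) :
  \sum_i F i = F (Some true) + F (Some false) + F None.
Proof.
rewrite (bigD1 None) //= (bigD1 (Some true)) //= (bigD1 (Some false)) //= big1.
  by rewrite addr0 addrC.
by case=> [[]|].
Qed.

Lemma sum_class3 (F : G -> R) i (B : {set G}) :
  [set u | class3 u == i] = B -> \sum_(u | class3 u == i) F u = \sum_(u in B) F u.
Proof. by move=> <-; apply: eq_bigl => u; rewrite inE. Qed.

Lemma notinX_two_values u : u \notin X -> x u = 1.
Proof. by move=> uX; rewrite /x (contraNF (fintype.subsetP AX u)). Qed.

Lemma sum_two_values_X f : f 1 = 1 :> R ->
  \sum_(u in X) f (x u) = #|A|%:R * f r + (#|X|%:R - #|A|%:R).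
Proof.
move=> f1; rewrite (big_setID A) /= (finset.setIidPr AX); congr (_ + _).
  under eq_bigr => u uA do rewrite /x uA.
  by rewrite sumr_const mulr_natl.
rewrite -natrB ?subset_leq_card // -cardsDS // -sumr_const.
by apply: eq_bigr => u; rewrite inE => /andP[/negPf uA _]; rewrite /x uA.
Qed.

Lemma sum_two_values_notX f (B : {set G}) : f 1 = 1 :> R -> [disjoint X & B] ->
  \sum_(u in B) f (x u) = #|B|%:R.
Proof.
move=> f1 XB; rewrite -sumr_const; apply: eq_bigr => u uB.
by rewrite notinX_two_values // (disjointFl XB).
Qed.

Lemma disjointXZ : [disjoint X & Z].
Proof. by rewrite disjoints_subset finset.setCK finset.subsetUl. Qed.

Local Notation xX := (#|A|%:R * r + (#|X|%:R - #|A|%:R)).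
Local Notation y := (#|Y|%:R : R).
Local Notation z := (#|Z|%:R : R).

Lemma class_sum3 : [/\ class_sum class3 x (Some true) = xX,
  class_sum class3 x (Some false) = y & class_sum class3 x None = z].
Proof.
rewrite /class_sum (sum_class3 _ class3_X) (sum_class3 _ class3_Y) (sum_class3 _ class3_Z).
by rewrite (sum_two_values_X (f := id)) // !(sum_two_values_notX (f := id)) // disjointXZ.
Qed.

Lemma sum_by_class3 (F : G -> R) :
  \sum_u F u = \sum_(u in X) F u + \sum_(u in Y) F u + \sum_(u in Z) F u.
Proof.
rewrite (partition_big class3 xpredT) //= sum_option_bool.
by rewrite (sum_class3 _ class3_X) (sum_class3 _ class3_Y) (sum_class3 _ class3_Z).
Qed.

Lemma sum_two_values f : f 1 = 1 :> R ->
  \sum_u f (x u) = #|A|%:R * f r + (#|X|%:R - #|A|%:R) + y + z.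
Proof.
by move=> f1; rewrite sum_by_class3 sum_two_values_X // !sum_two_values_notX // disjointXZ.
Qed.

(** A class has at most as many boundary vertices as cut edges; each of them pays its own value, at
    most [r] in [X] and 1 elsewhere, times the total of the other classes. *)
Lemma loss_le :
  \sum_u (bd u)%:R * x u * (\sum_v x v - class_sum class3 x (class3 u)) <=
  (cut X)%:R * (r * (y + z)) + (cut Y)%:R * (xX + z) + (cut Z)%:R * (xX + y).
Proof.
have [cX cY cZ] := class_sum3.
have T := sum_two_values (f := id) erefl; rewrite /= in T.
have r0 : 0 <= r := le_trans ler01 r1.
have xX0 : 0 <= xX.
  have : #|A|%:R <= #|X|%:R :> R by rewrite ler_nat subset_leq_card.
  have : 0 <= #|A|%:R * r by rewrite mulr_ge0 ?ler0n.
  lra.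
rewrite T sum_by_class3; apply: lerD; [apply: lerD|].
- apply: le_trans (_ : \sum_(u in X) (bd u)%:R * (r * (y + z)) <= _); last first.
    rewrite -mulr_suml ler_wpM2r ?mulr_ge0 ?addr_ge0 //.
    have := sum_boundary_le class3 (Some true).
    by rewrite class3_X (sum_class3 _ class3_X).
  apply: ler_sum => u uX; rewrite /class3 uX cX -mulrA ler_wpM2l // (_ : _ - _ = y + z); last by ring.
  by rewrite ler_wpM2r ?addr_ge0 // /x; case: ifP.
- apply: le_trans (_ : \sum_(u in Y) (bd u)%:R * (xX + z) <= _); last first.
    rewrite -mulr_suml ler_wpM2r ?(addr_ge0 xX0) //.
    have := sum_boundary_le class3 (Some false).
    by rewrite class3_Y (sum_class3 _ class3_Y).
  apply: ler_sum => u uY; have uX : u \notin X by rewrite (disjointFl XY).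
  rewrite notinX_two_values // /class3 (negPf uX) uY cY mulr1 ler_wpM2l //; lra.
- apply: le_trans (_ : \sum_(u in Z) (bd u)%:R * (xX + y) <= _); last first.
    rewrite -mulr_suml ler_wpM2r ?(addr_ge0 xX0) //.
    have := sum_boundary_le class3 None.
    by rewrite class3_Z (sum_class3 _ class3_Z).
  apply: ler_sum => u; rewrite !inE negb_or => /andP[uX uY].
  rewrite notinX_two_values // /class3 (negPf uX) (negPf uY) cZ mulr1 ler_wpM2l //; lra.
Qed.

(** [e] is distance in excess of [base_dist], and [ext] bounds from below half of what it adds to
    the form. *)
Lemma three_classes_radius s (e : G -> G -> R) (ext : R) (m := #|X|%:R - #|A|%:R) :
  (0 < s)%N -> (s < #|A|)%N -> (s < #|G| - #|A|)%N ->
  3 * #|A|%:R * r ^+ 2 + ((m + y + z) - #|A|%:R) * r = 3 * (m + y + z) ->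
  (forall u v, base_dist R class3 bd u v + e u v <= (dist u v)%:R) ->
  2 * ext <= \sum_u \sum_v e u v * x u * x v ->
  (cut X)%:R * (r * (y + z)) + (cut Y)%:R * (#|A|%:R * r + m + z) +
    (cut Z)%:R * (#|A|%:R * r + m + y) <
  2 * y * z + 2 * m * (y + z - #|A|%:R * r) + ext ->
  distance_spectral_radius R (two_cliques #|G| #|A| s) < distance_spectral_radius R G.
Proof.
move=> s0 sA sB er de eext est.
have G0 : (0 < #|G|)%N by lia.
have AG : (#|A| <= #|G|)%N by apply: max_card.
have bE : (#|G| - #|A|)%:R = m + y + z.
  rewrite natrB //; have := sum_two_values (f := fun=> 1) erefl.
  by rewrite sumr_const -[in X in X -> _]mulr_natl /m; lra.
have r0 : 0 < r := lt_le_trans ltr01 r1.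
have := two_cliques_radius_le (R := R) (r := r) s0 sA sB r0; rewrite bE => /(_ er) le_M.
rewrite ltNge; apply/negP => le_G.
have := distance_form_le G0 x.
rewrite (sum_two_values (f := fun t => t ^+ 2)) ?expr1n // => form_le.
have form_ge : \sum_u \sum_v base_dist R class3 bd u v * x u * x v +
    \sum_u \sum_v e u v * x u * x v <= \sum_u \sum_v (dist u v)%:R * x u * x v.
  rewrite -big_split; apply: ler_sum => u _; rewrite -big_split; apply: ler_sum => v _ /=.
  have x0 w : 0 <= x w by rewrite /x; case: ifP => _; lra.
  by rewrite -!mulrDl ler_wpM2r // ler_wpM2r.
move: form_ge; rewrite sum_base_dist sum_option_bool.
have [-> -> ->] := class_sum3.
rewrite (sum_two_values (f := fun t => t ^+ 2)) ?expr1n //.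
have := loss_le; rewrite (sum_two_values (f := id)) //= -/m.
set L := \sum_u _ * _ * _ => L_le form_ge.
have N0 : 0 <= #|A|%:R * r ^+ 2 + m + y + z.
  rewrite -(sum_two_values (f := fun t => t ^+ 2)) ?expr1n //.
  by apply: sumr_ge0 => u _; rewrite sqr_ge0.
rewrite -/m in form_le.
have form_le' := le_trans form_le (ler_wpM2r N0 (le_trans le_G (_ : _ <= 3 * #|A|%:R * r + (m + y + z) - 1))).
have {}form_le' := form_le' ltac:(lra).
(* The quadratic equation times [#|A| r] eliminates the cubic term in [r] from the product of the
   radius bound and the squared norm. *)
have er' := congr1 (fun t => #|A|%:R * r * t) er; rewrite /= in er'.
move: form_ge L_le est form_le' eext er'; move: L => L.
move: (\sum_u \sum_v _) => Q; move: (\sum_u \sum_v _) => E.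
lra.
Qed.

End ThreeClasses.

Lemma exists_subset_card (T : finType) (X : {set T}) m : (m <= #|X|)%N ->
  exists2 A : {set T}, A \subset X & #|A| = m.
Proof.
move=> mX; exists [set u in take m (enum X)].
  by apply/fintype.subsetP => u; rewrite inE => /mem_take; rewrite mem_enum.
rewrite cardsE; have /card_uniqP-> := take_uniq m (enum_uniq X).
by rewrite size_takel // -cardE.
Qed.

Lemma quadratic_root (R : realType) (a b : R) : 0 < a -> 0 < b ->
  exists2 r, 0 < r & 3 * a * r ^+ 2 + (b - a) * r = 3 * b.
Proof.
move=> a0 b0; pose D := (b - a) ^+ 2 + 36 * a * b; pose t := Num.sqrt D.
have ab : 0 < a * b by apply: mulr_gt0.
have D0 : 0 <= D by rewrite /D; have := sqr_ge0 (b - a); lra.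
have t0 : 0 <= t by apply: sqrtr_ge0.
have tt : t ^+ 2 = (b - a) ^+ 2 + 36 * a * b by rewrite sqr_sqrtr.
have tb : b - a < t by rewrite ltNge; apply/negP => h; nra.
exists ((t - (b - a)) / (6 * a)); first by rewrite divr_gt0; lra.
have a1 : a != 0 by rewrite gt_eqF.
have -> : 3 * a * ((t - (b - a)) / (6 * a)) ^+ 2 + (b - a) * ((t - (b - a)) / (6 * a)) =
  (t ^+ 2 - (b - a) ^+ 2) / (12 * a) by field.
by rewrite tt; field.
Qed.

(** * Application to three and to four parts *)

Section Parts.
Variables (R : realType) (G : sgraph) (k delta : nat).
Hypotheses (k2 : (2 <= k)%N) (kd : (6 * k - 4 <= delta)%N).

(** An edge leaving the complement, read backwards, leaves [X] or [Y]. *)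
Lemma cut_setC2 (X Y : {set G}) : (cut (~: (X :|: Y)) <= cut X + cut Y)%N.
Proof.
rewrite /cut; set A := [set a | _]; set B := [set a | _]; set C := [set a | _].
rewrite -(card_imset A (f := fun a : G * G => (a.2, a.1))); last by move=> [u v] [u' v'] [-> ->].
apply: leq_trans (_ : #|B :|: C| <= _)%N; last by rewrite (leq_card_setU B C).1.
apply/subset_leq_card/fintype.subsetP => _ /imsetP[[u v] h ->]; move: h.
rewrite !inE /= negbK negb_or => /and3P[uv /andP[uX uY]].
by rewrite adj_sym uv uX uY !andbT.
Qed.

Lemma boundary_dist (I : finType) (cl : G -> I) u v : (2 < #|G|)%N ->
  base_dist R cl (boundary cl) u v <= (dist u v)%:R.
Proof.
move=> G2; apply: base_dist_le => // w z wz cwz.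
by apply/existsP; exists z; rewrite wz.
Qed.

Local Notation M := (two_cliques #|G| delta.+1 k.-1).

Lemma three_parts_radius (X Y : {set G}) : [disjoint X & Y] -> (delta < #|X|)%N ->
  (#|X| <= #|Y|)%N -> (#|X| <= #|~: (X :|: Y)|)%N -> (cut X < 2 * k)%N ->
  (cut X + cut Y + cut (~: (X :|: Y)) <= 4 * k - 2)%N ->
  distance_spectral_radius R M < distance_spectral_radius R G.
Proof.
move=> XY dX XY' XZ cX c3.
have [A AX Aa] := exists_subset_card dX.
have nE : #|G| = (#|X| + #|Y| + #|~: (X :|: Y)|)%N.
  rewrite -(cardsC (X :|: Y)); congr addn; move: XY; rewrite -leq_card_setU.
  by move/eqP.
set z := #|~: _| in XZ nE *; set c := cut (~: _) in c3 *.
have [s0 sa sb G2] : [/\ (0 < k.-1)%N, (k.-1 < delta.+1)%N,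
    (k.-1 < #|G| - delta.+1)%N & (2 < #|G|)%N] by split; lia.
pose rn (j : nat) : R := j%:R.
have [||r r0 er] := @quadratic_root R (rn delta.+1)
  (rn #|X| - rn delta.+1 + rn #|Y| + rn z).
- by rewrite /rn ltr0n.
- by rewrite -addrA ltr_wpDl ?subr_ge0 ?ler_nat // /rn -natrD ltr0n; clear -dX XY'; lia.
have le1 : rn delta.+1 <= rn #|X| by rewrite ler_nat.
have le2 : rn #|X| <= rn #|Y| by rewrite ler_nat.
have le3 : rn #|X| <= rn z by rewrite ler_nat.
have a0 : 0 < rn delta.+1 by rewrite ltr0n.
have le4 : 3 * rn (cut X) <= rn delta.+1 by rewrite -natrM ler_nat; clear -cX k2 kd; lia.
have le5 : 3 * (rn (cut X) + rn (cut Y) + rn c) <= 2 * rn delta.+1.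
  by rewrite -!natrD -!natrM ler_nat; clear -c3 k2 kd; lia.
have [|r1 rb arb] := quadratic_root_bounds a0 _ r0 er; first by lra.
rewrite -Aa; apply: (three_classes_radius XY AX r1 (e := fun _ _ => 0) (ext := 0)).
- exact: s0.
- by rewrite Aa.
- by rewrite Aa.
- by rewrite Aa -/z.
- by move=> u v; rewrite addr0; apply: boundary_dist.
- by rewrite mulr0 big1 // => u _; rewrite big1 // => v _; rewrite !mul0r.
rewrite Aa -/z -/c addr0.
apply: (three_parts_estimate a0 r1 rb arb); rewrite ?ler0n //; rewrite -?/(rn _); lra.
Qed.

Lemma four_parts_radius (X Y Z : {set G}) : [disjoint X & Y] -> [disjoint X :|: Y & Z] ->
  (delta < #|X| <= #|Y|)%N -> (delta < #|Z|)%N -> (delta < #|~: (X :|: Y :|: Z)|)%N ->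
  (cut Z < delta)%N -> (cut X < 2 * k)%N -> (cut Y < 2 * k)%N ->
  distance_spectral_radius R M < distance_spectral_radius R G.
Proof.
move=> XY XYZ /andP[dX XY'] dZ dW cZ cX cY.
have [A AX Aa] := exists_subset_card dX.
have nE : #|G| = (#|X| + #|Y| + #|~: (X :|: Y)|)%N.
  rewrite -(cardsC (X :|: Y)); congr addn; move: XY; rewrite -leq_card_setU.
  by move/eqP.
set W := ~: (X :|: Y :|: Z) in dW.
have zE : #|~: (X :|: Y)| = (#|Z| + #|W|)%N.
  rewrite -(cardsID Z (~: (X :|: Y))); congr addn; apply: eq_card => u; rewrite !inE.
    by case: (boolP (u \in Z)) => uZ; rewrite ?andbF //; have := disjointFl XYZ uZ; rewrite inE => ->.
  by rewrite !negb_or andbC.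
have := cut_setC2 X Y.
set z := #|~: _| in nE zE *; set c := cut (~: _) => cle.
have [s0 sa sb G2] : [/\ (0 < k.-1)%N, (k.-1 < delta.+1)%N,
    (k.-1 < #|G| - delta.+1)%N & (2 < #|G|)%N] by split; lia.
pose rn (j : nat) : R := j%:R.
have [||r r0 er] := @quadratic_root R (rn delta.+1)
  (rn #|X| - rn delta.+1 + rn #|Y| + rn z).
- by rewrite /rn ltr0n.
- by rewrite -addrA ltr_wpDl ?subr_ge0 ?ler_nat // /rn -natrD ltr0n; clear -dX XY'; lia.
have le1 : rn delta.+1 <= rn #|X| by rewrite ler_nat.
have le2 : rn #|X| <= rn #|Y| by rewrite ler_nat.
have le3 : 2 * rn delta.+1 <= rn z.
  by rewrite -natrM ler_nat; clear -zE dZ dW; lia.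
have a9 : 9 <= rn delta.+1 by rewrite ler_nat; clear -k2 kd; lia.
have a0 : 0 < rn delta.+1 by rewrite ltr0n.
have le4 : 3 * rn (cut X) <= rn delta.+1 by rewrite -natrM ler_nat; clear -cX k2 kd; lia.
have le5 : 3 * rn (cut Y) <= rn delta.+1 by rewrite -natrM ler_nat; clear -cY k2 kd; lia.
have le6 : 3 * rn c <= 2 * rn delta.+1 by rewrite -!natrM ler_nat; clear -cle cX cY k2 kd; lia.
have [|r1 rb arb] := quadratic_root_bounds a0 _ r0 er; first by lra.
(* [Z] and [W] lie in the same class, where [base_dist] is 1 for distinct vertices; a nonadjacent
   pair gains 1. *)
pose f (u v : G) : R := ((u \in Z) && (v \in W) && ~~ adj u v)%:R.
have Zcl u : u \in Z -> class3 X Y u = None.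
  move=> uZ; have := disjointFl XYZ uZ; rewrite inE => /norP[uX uY].
  by rewrite /class3 (negPf uX) (negPf uY).
have Wcl u : u \in W -> class3 X Y u = None.
  by rewrite !inE !negb_or => /andP[/andP[uX uY] _]; rewrite /class3 (negPf uX) (negPf uY).
have ZW u v : u \in Z -> v \in W -> u != v.
  by move=> uZ; rewrite inE; apply: contraNneq => <-; rewrite inE uZ orbT.
have fd u v : u \in Z -> v \in W -> ~~ adj u v ->
    base_dist R (class3 X Y) (boundary (class3 X Y)) u v + 1 <= (dist u v)%:R.
  move=> uZ vW uv; rewrite /base_dist (Zcl u) // (Wcl v) // eqxx mul0r addr0 ZW //.
  have : 2 <= (dist u v)%:R :> R by rewrite ler_nat dist_ge2 // ZW.
  by rewrite /=; lra.
rewrite -Aa; apply: (three_classes_radius XY AX r1 (e := fun u v => f u v + f v u)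
  (ext := rn delta.+1 * (rn z - rn delta.+1) - rn delta.+1)).
- exact: s0.
- by rewrite Aa.
- by rewrite Aa.
- by rewrite Aa -/z.
- move=> u v; have base := boundary_dist (class3 X Y) u v G2.
  rewrite /f; case: (boolP (_ && _)) => [/andP[/andP[uZ vW] uv]|_].
    have vZ : v \notin Z by apply: contraTN vW => vZ; rewrite !inE vZ orbT.
    by rewrite (negPf vZ) addr0; apply: fd.
  case: (boolP (_ && _)) => [/andP[/andP[vZ uW] uv]|_]; last by rewrite !addr0.
  rewrite add0r dist_sym; have := fd _ _ vZ uW uv.
  by congr (_ + _ <= _); rewrite /base_dist eq_sym (eq_sym (class3 X Y v)); ring.
- set x := two_values A r.
  have xf u v : f u v * x u * x v = f u v.
    rewrite /f; case: (boolP (_ && _)) => [/andP[/andP[uZ vW] _]|_]; last by rewrite !mul0r.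
    rewrite /x !(notinX_two_values r AX) ?mulr1 //.
      by move: vW; rewrite !inE !negb_or => /andP[/andP[]].
    by have := disjointFl XYZ uZ; rewrite inE => /norP[].
  have -> : \sum_u \sum_v (f u v + f v u) * x u * x v = 2 * \sum_u \sum_v f u v.
    rewrite mulr_natl mulr2n [X in _ = _ + X]exchange_big /= -big_split; apply: eq_bigr => u _.
    rewrite -big_split; apply: eq_bigr => v _ /=.
    by rewrite !mulrDl xf -[in RHS](xf v u); ring.
  rewrite ler_pM2l //.
  have fE : rn #|Z| * rn #|W| - rn (cut Z) <= \sum_u \sum_v f u v.
    rewrite /f pair_bigA /= -natr_sum lerBlDr -natrD -natrM ler_nat.
    rewrite -cardsX.
    rewrite (eq_bigr (fun p => if (p.1 \in Z) && (p.2 \in W) && ~~ adj p.1 p.2 then 1%N else 0%N));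
      last by move=> p _; case: ifP.
    rewrite -big_mkcond sum1_card -(cardsID [set p : G * G | adj p.1 p.2] (setX Z W)) addnC.
    apply: leq_add; apply/subset_leq_card/fintype.subsetP => -[u v].
      rewrite in_setD in_setX inE /= => /and3P[nuv uZ vW].
      by rewrite unfold_in /= uZ vW nuv.
    rewrite !inE /= => /andP[/andP[uZ]]; rewrite !negb_or => /andP[_ vZ] uv.
    by rewrite uv uZ vZ.
  apply: le_trans fE; have zE' : rn z = rn #|Z| + rn #|W| by rewrite /rn zE natrD.
  have h1 : rn delta.+1 <= rn #|Z| by rewrite ler_nat.
  have h2 : rn delta.+1 <= rn #|W| by rewrite ler_nat.
  have h3 : rn (cut Z) <= rn delta.+1 by rewrite ler_nat ltnW // ltnW.
  rewrite zE'; nra.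
rewrite Aa -/z -/c.
apply: (four_parts_estimate a9 r1 rb arb); rewrite ?ler0n //; rewrite -?/(rn _); lra.
Qed.

End Parts.

(** * Bipartitions *)

Section TwoCliquesIso.
Variables (G : sgraph) (X S T : {set G}) (s : nat).
Hypothesis G0 : (0 < #|G|)%N.
Hypotheses (SX : S \subset X) (TX : T \subset ~: X) (cS : #|S| = s) (cT : #|T| = s).
Hypothesis cliques : forall u v : G, u != v -> (u \in X) = (v \in X) -> adj u v.
Hypothesis crossST : forall u v : G, u \in X -> v \notin X -> adj u v -> u \in S /\ v \in T.
Hypothesis coverS : forall u, u \in S -> exists2 v, v \in T & adj u v.
Hypothesis coverT : forall v, v \in T -> exists2 u, u \in S & adj u v.
Hypothesis cutX : (cut X <= s)%N.

Let E := [set a : G * G | [&& adj a.1 a.2, a.1 \in X & a.2 \notin X]].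

(** The projections of at most [s] cut edges cover the [s] vertices of [S] and of [T], so both are
    injective. *)
Lemma cross_edges_matching : {in E &, injective fst} /\ {in E &, injective snd}.
Proof.
have SE : S \subset fst @: E.
  apply/fintype.subsetP => u uS; have [v vT uv] := coverS uS.
  apply/imsetP; exists (u, v); rewrite // inE /= uv (fintype.subsetP SX) //=.
  by have := fintype.subsetP TX v vT; rewrite inE.
have TE : T \subset snd @: E.
  apply/fintype.subsetP => v vT; have [u uS uv] := coverT vT.
  apply/imsetP; exists (u, v); rewrite // inE /= uv (fintype.subsetP SX) //=.
  by have := fintype.subsetP TX v vT; rewrite inE.
split; apply/imset_injP; rewrite eqn_leq leq_imset_card /=.
  by apply: leq_trans (subset_leq_card SE); rewrite cS.
by apply: leq_trans (subset_leq_card TE); rewrite cT.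
Qed.

Let mate (u : G) : G := odflt u [pick v in T | adj u v].

Let mateP u : u \in S -> mate u \in T /\ adj u (mate u).
Proof.
move=> uS; rewrite /mate; case: pickP => [v /andP[]//|none].
by have [v vT uv] := coverS uS; have := none v; rewrite vT uv.
Qed.

Let mate_unique u v : u \in S -> v \in S -> adj u (mate v) -> u = v.
Proof.
move=> uS vS uv; have [mT vm] := mateP vS; have [_ injE] := cross_edges_matching.
have mX : mate v \notin X by have := fintype.subsetP TX _ mT; rewrite inE.
have inE' w : w \in S -> adj w (mate v) -> (w, mate v) \in E.
  by move=> wS wv; rewrite inE /= wv mX (fintype.subsetP SX).
by have [] := injE _ _ (inE' u uS uv) (inE' v vS vm) erefl.
Qed.

Lemma two_cliques_iso : isomorphic G (two_cliques #|G| #|X| s).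
Proof.
have /card_gt0P[x0 _] := G0.
have cC : #|~: X| = (#|G| - #|X|)%N by rewrite -(cardsC X) addKn.
(* The mates are listed in the order of [S], so that for [i < s] the vertices at position [i] of the
   two lists are matched. *)
pose lA := enum S ++ enum (X :\: S).
pose lB := map mate (enum S) ++ enum (~: X :\: T).
have sA : size lA = #|X|.
  by rewrite size_cat -!cardE -(cardsID S X) (finset.setIidPr SX).
have sB : size lB = (#|G| - #|X|)%N.
  by rewrite size_cat size_map -!cardE cS -cC -(cardsID T (~: X)) (finset.setIidPr TX) cT.
have memA u : u \in lA -> u \in X.
  rewrite mem_cat !mem_enum => /orP[/(fintype.subsetP SX)//|].
  by rewrite inE => /andP[].
have memB u : u \in lB -> u \notin X.
  rewrite mem_cat mem_enum !inE => /orP[/mapP[v]|/andP[]//].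
  by rewrite mem_enum => /mateP[/(fintype.subsetP TX) + _] ->; rewrite inE.
have uA : uniq lA.
  rewrite cat_uniq !enum_uniq andbT /=; apply/hasPn => u.
  by rewrite !mem_enum inE => /andP[].
have uB : uniq lB.
  rewrite cat_uniq enum_uniq andbT map_inj_in_uniq ?enum_uniq /=; last first.
    move=> u v; rewrite !mem_enum => uS vS e; apply: mate_unique => //.
    by rewrite -e; case: (mateP uS).
  apply/hasPn => u; rewrite mem_enum inE => /andP[uT _]; apply: contra uT => /mapP[v].
  by rewrite mem_enum => /mateP[? _] ->.
have szS : size (enum S) = s by rewrite -cardE cS.
pose h (v : two_cliques #|G| #|X| s) : G :=
  match v with inl i => nth x0 lA i | inr j => nth x0 lB j end.
have hA (i : 'I_#|X|) : nth x0 lA i \in X by apply: memA; rewrite mem_nth ?sA.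
have hB (j : 'I_(#|G| - #|X|)) : nth x0 lB j \notin X by apply: memB; rewrite mem_nth ?sB.
have adjcl (u v : G) : (u \in X) = (v \in X) -> adj u v = (u != v).
  by move=> uv; have [->|ne] := eqVneq u v; [rewrite adj_irrefl | rewrite cliques].
have hcross (i : 'I_#|X|) (j : 'I_(#|G| - #|X|)) :
    adj (nth x0 lA i) (nth x0 lB j) = (i == j :> nat) && (i < s)%N.
  have AS : (nth x0 lA i \in S) = (i < s)%N.
    rewrite nth_cat szS; case: ifP => si.
      by rewrite -mem_enum mem_nth // szS.
    have : nth x0 (enum (X :\: S)) (i - s) \in enum (X :\: S).
      rewrite mem_nth // -cardE cardsDS // cS ltn_sub2r //.
        by apply: leq_ltn_trans (ltn_ord i); rewrite leqNgt si.
    by rewrite mem_enum inE => /andP[/negPf].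
  have BT : (nth x0 lB j \in T) = (j < s)%N.
    rewrite nth_cat size_map szS; case: ifP => sj.
      rewrite (nth_map x0) ?szS //.
      have /mateP[-> //] : nth x0 (enum S) j \in S by rewrite -mem_enum mem_nth // szS.
    have : nth x0 (enum (~: X :\: T)) (j - s) \in enum (~: X :\: T).
      rewrite mem_nth // -cardE cardsDS // cT cC ltn_sub2r //.
        by apply: leq_ltn_trans (ltn_ord j); rewrite leqNgt sj.
    by rewrite mem_enum inE => /andP[/negPf].
  apply/idP/andP => [ad|[/eqP ij si]].
    have [iS jT] := crossST (hA i) (hB j) ad.
    move: iS jT ad; rewrite AS BT => si sj.
    rewrite !nth_cat size_map szS si sj (nth_map x0) ?szS // => /mate_unique e.
    split=> //; rewrite -(nth_uniq x0 _ _ (enum_uniq S)) ?szS //.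
    by apply/eqP/e; rewrite -mem_enum mem_nth // szS.
  rewrite !nth_cat size_map szS -ij si (nth_map x0) ?szS //.
  have : nth x0 (enum S) i \in S by rewrite -mem_enum mem_nth // szS.
  by case/mateP.
have hadj u v : adj (h u) (h v) = adj u v.
  case: u v => [i|i] [j|j] /=.
  - by rewrite adjcl ?hA // nth_uniq ?sA.
  - exact: hcross.
  - by rewrite adj_sym hcross.
  - by rewrite adjcl ?(negPf (hB _)) // nth_uniq ?sB.
have injh : injective h.
  move=> u v e; have : ~~ adj (h u) (h v) by rewrite e adj_irrefl.
  rewrite hadj; case: u v e => [i|i] [j|j] /= e.
  - by rewrite negbK => /eqP->.
  - by have := hA i; rewrite e (negPf (hB j)).
  - by have := hA j; rewrite -e (negPf (hB i)).
  - by rewrite negbK => /eqP->.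
have cardM : #|two_cliques #|G| #|X| s| = #|G|.
  by rewrite card_sum !card_ord subnKC // max_card.
have [g hK gK] : bijective h by apply: inj_card_bij => //; rewrite cardM.
exists g; first by exists h.
by move=> u v; rewrite -hadj !gK.
Qed.

End TwoCliquesIso.

(* Moving [m] vertices of the larger clique to the smaller one changes the
   distance form by [2 m xQ] times the quantity bounded here. *)
Lemma move_vertices_gain (R : realFieldType) (l p q s m xP xS xT xQ : R) :
  [/\ 0 < xP, 0 < xS, 0 < xT & 0 < xQ] ->
  [/\ l * xP = (p - 1) * xP + s * xS + 2 * s * xT + 3 * q * xQ,
      l * xS = p * xP + (s - 1) * xS + (2 * s - 1) * xT + 2 * q * xQ,
      l * xT = 2 * p * xP + (2 * s - 1) * xS + (s - 1) * xT + q * xQ &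
      l * xQ = 3 * p * xP + 2 * s * xS + s * xT + (q - 1) * xQ] ->
  1 <= p -> 1 <= s -> 0 < m -> 2 * m <= q - p ->
  0 < 2 * q * xQ - 2 * p * xP + s * xT - s * xS - 2 * (m * xQ).
Proof.
move=> [xP0 xS0 xT0 xQ0] [eP eS eT eQ] p1 s1 m0 mqp.
(* The four equations are added with the class sizes as weights; [q >= p] makes the remaining
   coefficients nonnegative. *)
have l_ge : 2 * p + s <= l.
  have sum0 : 0 < p * xP + s * xS + s * xT + q * xQ.
    by rewrite !addr_gt0 ?mulr_gt0 //; lra.
  rewrite -(ler_pM2r sum0).
  have -> : l * (p * xP + s * xS + s * xT + q * xQ) =
      p * (l * xP) + s * (l * xS) + s * (l * xT) + q * (l * xQ) by ring.
  rewrite eP eS eT eQ.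
  have h1 : 0 <= (p * xP) * (3 * q - p + 2 * s - 1) by apply: mulr_ge0; [apply: mulr_ge0|]; lra.
  have h2 : 0 <= (s * xS) * (2 * q - p + 2 * s - 2) by apply: mulr_ge0; [apply: mulr_ge0|]; lra.
  have h3 : 0 <= (s * xT) * (q + 2 * s - 2) by apply: mulr_ge0; [apply: mulr_ge0|]; lra.
  have h4 : 0 <= (q * xQ) * (p + q + 2 * s - 1) by apply: mulr_ge0; [apply: mulr_ge0|]; lra.
  lra.
(* Subtracting the equations of opposite classes leaves a linear system in [u], [v], [w] and [xQ];
   [key] solves it for [u]. *)
pose u := xP - xQ; pose v := xS - xT; pose w := q * xQ - p * xP.
have -> : 2 * q * xQ - 2 * p * xP + s * xT - s * xS - 2 * (m * xQ) = (l + 1) * u - 2 * m * xQ.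
  by rewrite /u; lra.
have ev : (l + s) * v = w by rewrite /v /w; lra.
have eu : (l + 1) * u = 2 * w - s * v by rewrite /u /v /w; lra.
have ew : w = (q - p) * xQ - p * u by rewrite /w /u; ring.
have l0 : 0 < l by lra.
have key : u * ((l + 1) * (l + s) + p * (2 * l + s)) = (2 * l + s) * ((q - p) * xQ).
  have : (l + s) * ((l + 1) * u) = (2 * l + s) * w.
    by rewrite eu mulrBr mulrCA (mulrCA _ s) ev; ring.
  rewrite {1}ew; lra.
have c0 : 0 < (l + 1) * (l + s) + p * (2 * l + s).
  by rewrite addr_gt0 // mulr_gt0 //; lra.
have Q0 : 0 < (q - p) * xQ by rewrite mulr_gt0 //; lra.
have : (q - p) * xQ < (l + 1) * u.
  rewrite -(ltr_pM2r c0) -[X in _ < X]mulrA key.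
  have : 0 < (q - p) * xQ * ((l + 1) * l - p * (2 * l + s)).
    rewrite mulr_gt0 //.
    have : (2 * p + s) * l <= l * l by apply: ler_wpM2r; lra.
    have : p * s <= l * s by apply: ler_wpM2r; lra.
    lra.
  lra.
have : 2 * m * xQ <= (q - p) * xQ by apply: ler_wpM2r; lra.
lra.
Qed.

(** * Comparison of a bipartition with the two cliques *)

Section Bipartition.
Variables (R : realType) (G : sgraph) (X : {set G}) (a s : nat).
Hypotheses (s0 : (0 < s)%N) (sa : (s < a)%N) (aX : (a <= #|X|)%N) (XX : (#|X| <= #|~: X|)%N).
Hypothesis cutX : (cut X <= s)%N.

Lemma cut_setC : cut (~: X) = cut X.
Proof.
rewrite /cut; set A := [set a | _]; set B := [set a | _].
rewrite -(card_imset A (f := fun a : G * G => (a.2, a.1))); last by move=> [u v] [u' v'] [-> ->].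
apply: eq_card => -[u v]; apply/imsetP/idP => [[[u' v'] h [-> ->]]|h].
  by move: h; rewrite !inE /= negbK adj_sym => /and3P[-> -> ->].
by exists (v, u) => //; move: h; rewrite !inE /= negbK adj_sym => /and3P[-> -> ->].
Qed.

Lemma exists_set_between (A B : {set G}) m : A \subset B -> (#|A| <= m <= #|B|)%N ->
  exists C : {set G}, [/\ A \subset C, C \subset B & #|C| = m].
Proof.
move=> AB /andP[Am mB].
have [|D DBA Dm] := @exists_subset_card _ (B :\: A) (m - #|A|).
  by rewrite cardsDS // leq_sub2r.
have /andP[DB AD] : (D \subset B) && [disjoint D & A] by rewrite -subsetD.
exists (A :|: D); split; first exact: finset.subsetUl.
  by rewrite subUset AB DB.
have := leq_card_setU A D; rewrite disjoint_sym AD => -[_ /eqP->].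
by rewrite Dm subnKC.
Qed.

(* The endpoints of the cut edges in a part, padded to [s] vertices. *)
Lemma exists_endpoints (B : {set G}) : (cut B <= s)%N -> (s <= #|B|)%N ->
  exists C : {set G}, [/\ C \subset B, #|C| = s &
    forall u v, u \in B -> v \notin B -> adj u v -> u \in C].
Proof.
move=> cB sB; pose D := [set u in B | [exists v, (v \notin B) && adj u v]].
have DB : D \subset B by apply/fintype.subsetP => u; rewrite inE => /andP[].
have Ds : (#|D| <= s)%N.
  apply: leq_trans cB; apply: leq_trans (leq_imset_card fst [in [set a : G * G |
    [&& adj a.1 a.2, a.1 \in B & a.2 \notin B]]]).
  apply/subset_leq_card/fintype.subsetP => u; rewrite inE => /andP[uB /existsP[v /andP[vB uv]]].
  by apply/imsetP; exists (u, v); rewrite // !inE /= uv uB vB.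
have [|C [DC CB Cs]] := @exists_set_between D B s DB; first by rewrite Ds.
exists C; split=> // u v uB vB uv; apply: (fintype.subsetP DC).
by rewrite inE uB; apply/existsP; exists v; rewrite vB.
Qed.

Theorem bipartition_radius :
  distance_spectral_radius R G <= distance_spectral_radius R (two_cliques #|G| a s) ->
  isomorphic G (two_cliques #|G| a s).
Proof.
have nE : #|G| = (#|X| + #|~: X|)%N by rewrite cardsC.
have sb : (s < #|G| - a)%N by lia.
have G2 : (2 < #|G|)%N by lia.
have G0 : (0 < #|G|)%N by lia.
have [S [SX Ss endS]] := exists_endpoints cutX (ltnW (leq_trans sa aX)).
have [||T [TX Ts endT]] := @exists_endpoints (~: X).
- by rewrite cut_setC.
- by apply: ltnW; apply: leq_trans sa (leq_trans aX XX).
(* [A] imitates the clique of order [a]; the surplus vertices [X :\: A] will get the value [xQ] of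
   the larger clique. *)
have [|A [SA AX Aa]] := @exists_set_between S X a SX; first by rewrite Ss ltnW.
have crossST u v : u \in X -> v \notin X -> adj u v -> u \in S /\ v \in T.
  move=> uX vX uv; split; first exact: endS uv.
  by apply: (endT v u); rewrite ?inE ?negbK // adj_sym.
have [xP [xS [xT [xQ [pos eqs]]]]] := two_cliques_perron R s0 sa sb.
have [xP0 xS0 xT0 xQ0] := pos; have [eP eS eT eQ] := eqs.
set l := distance_spectral_radius _ (two_cliques _ _ _) in eP eS eT eQ eqs *.
move=> le_G.
have SnT u : u \in S -> u \notin T.
  move=> /(fintype.subsetP SX) uX; apply: contraTN uX => /(fintype.subsetP TX).
  by rewrite inE.
have TnA u : u \in T -> u \notin A.
  move=> /(fintype.subsetP TX); rewrite inE; apply: contra; exact: (fintype.subsetP AX).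
pose x u := if u \in S then xS else if u \in A then xP else if u \in T then xT else xQ.
have x0 u : 0 < x u by rewrite /x; do 3!case: ifP => _ //.
pose cl u := u \in X; pose bd u := (u \in S) || (u \in T).
(* Between [S] and [T] the value of [base_dist] is 1, which a nonadjacent pair exceeds by at least
   1. *)
pose f u v : R := [&& u \in S, v \in T & ~~ adj u v]%:R.
have base u v : base_dist R cl bd u v + (f u v + f v u) <= (dist u v)%:R.
  have b := @base_dist_le R G _ cl bd u v G2.
  have {}b : base_dist R cl bd u v <= (dist u v)%:R.
    apply: b => w z wz; rewrite /cl /bd; have [wX|wX] := boolP (w \in X).
      by case: (boolP (z \in X)) => // zX _; have [->] := crossST w z wX zX wz.
    case: (boolP (z \in X)) => // zX _.
    by have [|_ ->] := crossST z w zX wX; rewrite 1?adj_sym // orbT.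
  have far w z : w \in S -> z \in T -> ~~ adj w z -> (base_dist R cl bd w z + 1 <= (dist w z)%:R).
    move=> wS zT wz.
    have wX := fintype.subsetP SX w wS.
    have zX : z \notin X by have := fintype.subsetP TX z zT; rewrite inE.
    have neq : w != z by apply: contraNneq zX => <-.
    rewrite /base_dist /cl /bd wX (negPf zX) wS zT orbT neq /=.
    have : 2 <= (dist w z)%:R :> R by rewrite ler_nat dist_ge2.
    lra.
  rewrite /f; case: (boolP [&& u \in S, _ & _]) => [/and3P[uS vT uv]|_].
    by rewrite (negPf (SnT u uS)) andbF addr0; apply: far.
  case: (boolP [&& v \in S, _ & _]) => [/and3P[vS uT uv]|_]; last by rewrite !addr0.
  rewrite add0r dist_sym; have := far _ _ vS uT uv.
  by congr (_ + _ <= _); rewrite /base_dist eq_sym (eq_sym (cl v)); ring.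
have sum_const (B : {set G}) (F : G -> R) c : (forall u, u \in B -> F u = c) ->
    \sum_(u in B) F u = #|B|%:R * c.
  by move=> h; rewrite (eq_bigr (fun=> c)) // sumr_const mulr_natl.
pose p : R := (a - s)%:R; pose q : R := (#|G| - a - s)%:R; pose sr : R := s%:R.
pose m : R := (#|X| - a)%:R.
have cX : #|X :\: A| = (#|X| - a)%N by rewrite cardsDS // Aa.
have cA : #|A :\: S| = (a - s)%N by rewrite cardsDS // Aa Ss.
have cT : #|~: X :\: T|%:R = q - m.
  rewrite cardsDS // Ts /q /m -natrB; first by congr _%:R; clear -nE XX aX sa; lia.
  by clear -nE XX aX sa; lia.
have sumX g : \sum_(u in X) g (x u) = sr * g xS + p * g xP + m * g xQ.
  rewrite (big_setID A) /= (finset.setIidPr AX) (big_setID S) /= (finset.setIidPr SA).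
  rewrite (sum_const S _ (g xS)) ?(sum_const (A :\: S) _ (g xP)) ?(sum_const (X :\: A) _ (g xQ)).
  - by rewrite cX cA Ss.
  - move=> u /setDP[uX uA]; rewrite /x (negPf uA).
    rewrite (negPf (contra (fintype.subsetP SA u) uA)).
    by case: ifP => // /(fintype.subsetP TX); rewrite inE uX.
  - by move=> u /setDP[uA uS]; rewrite /x (negPf uS) uA.
  - by move=> u uS; rewrite /x uS.
have sumXC g : \sum_(u | u \notin X) g (x u) = sr * g xT + (q - m) * g xQ.
  rewrite (eq_bigl [in ~: X]) => [|u]; last by rewrite !inE.
  rewrite (big_setID T) /= (finset.setIidPr TX).
  rewrite (sum_const T _ (g xT)) ?(sum_const (~: X :\: T) _ (g xQ)) ?cT ?Ts //.
    move=> u; rewrite !inE => /andP[uT uX]; rewrite /x (negPf uT).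
    by rewrite (negPf (contra (fintype.subsetP SX u) uX)) (negPf (contra (fintype.subsetP AX u) uX)).
  move=> u uT; have uA := TnA u uT; rewrite /x uT (negPf uA).
  by rewrite (negPf (contra (fintype.subsetP SA u) uA)).
have sumT g : \sum_u g (x u) = sr * g xS + p * g xP + sr * g xT + q * g xQ.
  by rewrite (bigID [in X]) /= sumX sumXC; ring.
have cst : class_sum cl x true = sr * xS + p * xP + m * xQ.
  by rewrite -(sumX id); apply: eq_bigl => u; rewrite /cl eqb_id.
have csf : class_sum cl x false = sr * xT + (q - m) * xQ.
  by rewrite -(sumXC id); apply: eq_bigl => u; rewrite /cl eqbF_neg.
pose N := \sum_u x u ^+ 2.
have NE : N = sr * xS ^+ 2 + p * xP ^+ 2 + sr * xT ^+ 2 + q * xQ ^+ 2.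
  exact: (sumT (fun t => t ^+ 2)).
have lossE : \sum_u (bd u)%:R * x u * (\sum_v x v - class_sum cl x (cl u)) =
    sr * (xS * (sr * xT + (q - m) * xQ)) + sr * (xT * (sr * xS + p * xP + m * xQ)).
  rewrite (sumT id) (bigID [in X]) /=; congr (_ + _).
    rewrite (big_setID S) /= (finset.setIidPr SX).
    rewrite (sum_const S _ (xS * (sr * xT + (q - m) * xQ))) ?Ss; last first.
      move=> u uS; rewrite /cl (fintype.subsetP SX u uS) cst /bd /x uS mul1r.
      by congr (_ * _); ring.
    rewrite (sum_const (X :\: S) _ 0) ?mulr0 ?addr0 // => u /setDP[uX uS].
    rewrite /bd (negPf uS); have -> : u \in T = false.
      by apply: contraTF uX => /(fintype.subsetP TX); rewrite inE.
    by rewrite !mul0r.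
  rewrite (eq_bigl [in ~: X]) => [|u]; last by rewrite !inE.
  rewrite (big_setID T) /= (finset.setIidPr TX).
  rewrite (sum_const T _ (xT * (sr * xS + p * xP + m * xQ))) ?Ts; last first.
    move=> u uT; have uA := TnA u uT; have := fintype.subsetP TX u uT; rewrite inE => uX.
    rewrite /cl (negPf uX) csf /bd /x uT orbT (negPf uA).
    rewrite (negPf (contra (fintype.subsetP SA u) uA)) mul1r.
    by congr (_ * _); ring.
  rewrite (sum_const (~: X :\: T) _ 0) ?mulr0 ?addr0 // => u; rewrite !inE => /andP[uT uX].
  by rewrite /bd (negPf uT) (negPf (contra (fintype.subsetP SX u) uX)) !mul0r.
pose nadj := #|[set e : G * G | [&& e.1 \in S, e.2 \in T & ~~ adj e.1 e.2]]|.
have fE : \sum_u \sum_v (f u v + f v u) * x u * x v = 2 * (nadj%:R * (xS * xT)).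
  have xf u v : f u v * x u * x v = f u v * (xS * xT).
    rewrite /f; case: (boolP [&& _, _ & _]) => [/and3P[uS vT _]|_]; last by rewrite !mul0r.
    have vA := TnA v vT; rewrite /x uS vT (negPf vA).
    by rewrite (negPf (contra (fintype.subsetP SA v) vA)) mulrA.
  have -> : nadj%:R * (xS * xT) = \sum_u \sum_v f u v * (xS * xT).
    rewrite pair_bigA /= -mulr_suml; congr (_ * _); rewrite /f /= -natr_sum; congr _%:R.
    rewrite /nadj -sum1_card big_mkcond /=; apply: eq_bigr => -[u v] _ /=.
    by rewrite inE /=; case: ifP.
  rewrite mulr_natl mulr2n [X in _ = _ + X]exchange_big /= -big_split; apply: eq_bigr => u _.
  rewrite -big_split; apply: eq_bigr => v _ /=.
  by rewrite -!xf; ring.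
(* At most [s] of the [s ^ 2] pairs between [S] and [T] are adjacent. *)
have nadj_ge : sr ^+ 2 - sr <= nadj%:R.
  rewrite lerBlDr -natrX -natrD ler_nat.
  apply: leq_trans (leq_add (leqnn _) cutX).
  have -> : (s ^ 2 = #|setX S T|)%N by rewrite cardsX Ss Ts.
  rewrite -(cardsID [set e : G * G | adj e.1 e.2] (setX S T)) addnC.
  apply: leq_add; apply/subset_leq_card/fintype.subsetP => -[u v].
    by rewrite !inE /= => /and3P[-> -> ->].
  rewrite !inE /= => /andP[/andP[uS vT] ->]; rewrite (fintype.subsetP SX u uS) /=.
  by have := fintype.subsetP TX v vT; rewrite inE.
have G_le : \sum_u \sum_v (dist u v)%:R * x u * x v <= l * N.
  apply: le_trans (distance_form_le G0 x) _; apply: ler_wpM2r le_G.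
  by apply: sumr_ge0 => u _; rewrite sqr_ge0.
pose low u v := base_dist R cl bd u v + (f u v + f v u).
pose w := m * xQ.
(* The eigenvalue equations turn the lower bound into [l * N], plus the effect of moving [m]
   vertices, plus that of additional nonadjacent pairs between [S] and [T]. *)
have low_eq : \sum_u \sum_v low u v * x u * x v =
    l * N + 2 * w * (2 * q * xQ - 2 * p * xP + sr * xT - sr * xS - 2 * w) +
    2 * (nadj%:R - (sr ^+ 2 - sr)) * (xS * xT).
  have -> : \sum_u \sum_v low u v * x u * x v =
      \sum_u \sum_v base_dist R cl bd u v * x u * x v +
      \sum_u \sum_v (f u v + f v u) * x u * x v.
    rewrite -big_split; apply: eq_bigr => u _; rewrite -big_split; apply: eq_bigr => v _ /=.
    by rewrite -!mulrDl.
  rewrite fE sum_base_dist lossE (sumT id) -/N big_bool cst csf /=.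
  have -> : l * N = sr * xS * (l * xS) + p * xP * (l * xP) + sr * xT * (l * xT) + q * xQ * (l * xQ).
    by rewrite NE; ring.
  by rewrite eP eS eT eQ NE /w; ring.
have d_low : \sum_u \sum_v low u v * x u * x v <= \sum_u \sum_v (dist u v)%:R * x u * x v.
  apply: ler_sum => u _; apply: ler_sum => v _.
  by do 2!(apply: ler_wpM2r; first exact: ltW); apply: base.
have ST0 : 0 < xS * xT by apply: mulr_gt0.
have nadj0 : 0 <= (nadj%:R - (sr ^+ 2 - sr)) * (xS * xT) by rewrite mulr_ge0 ?subr_ge0 // ltW.
have Xa : #|X| = a.
  apply/eqP; rewrite eqn_leq aX andbT leqNgt; apply/negP => aX'.
  have m0 : 0 < m by rewrite ltr0n subn_gt0.
  have p1 : 1 <= p by rewrite ler1n subn_gt0.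
  have s1 : 1 <= sr by rewrite ler1n.
  have mqp : 2 * m <= q - p.
    by rewrite lerBrDr -natrM -natrD ler_nat; clear -nE XX aX sa; lia.
  have gain := move_vertices_gain pos eqs p1 s1 m0 mqp; rewrite -/w in gain.
  have w0 : 0 < w by apply: mulr_gt0.
  have : 0 < 2 * w * (2 * q * xQ - 2 * p * xP + sr * xT - sr * xS - 2 * w).
    by apply: mulr_gt0 => //; apply: mulr_gt0.
  move: low_eq d_low G_le nadj0; clear -R; lra.
have w0 : w = 0 by rewrite /w /m Xa subnn mul0r.
rewrite w0 mulr0 mul0r addr0 in low_eq.
(* The form of [G] is squeezed to [l * N], and [x] is positive, so each distance meets its lower
   bound. *)
have tight : forall u v, (dist u v)%:R = low u v.
  have : \sum_u \sum_v ((dist u v)%:R - low u v) * x u * x v <= 0.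
    have -> : \sum_u \sum_v ((dist u v)%:R - low u v) * x u * x v =
       \sum_u \sum_v (dist u v)%:R * x u * x v - \sum_u \sum_v low u v * x u * x v.
      rewrite -sumrB; apply: eq_bigr => u _; rewrite -sumrB; apply: eq_bigr => v _.
      by rewrite !mulrBl.
    lra.
  have ge0 u v : 0 <= ((dist u v)%:R - low u v) * x u * x v.
    by rewrite !mulr_ge0 ?subr_ge0 ?base // ltW.
  move=> le0 u v; apply/eqP; rewrite -subr_eq0.
  have : ((dist u v)%:R - low u v) * x u * x v <= 0.
    apply: le_trans le0; rewrite (bigD1 u) //= (bigD1 v) //= -addrA lerDl addr_ge0 //.
      by apply: sumr_ge0 => w' _; apply: ge0.
    by apply: sumr_ge0 => w' _; apply: sumr_ge0 => w'' _; apply: ge0.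
  rewrite pmulr_lle0 // pmulr_lle0 // => h; rewrite eq_le h subr_ge0.
  exact: base.
have adj1 (u v : G) : dist u v = 1%N -> adj u v.
  move=> d1; have := @dist_lt G u v; rewrite d1 => h.
  by apply: has_path1; apply: h; apply: ltn_trans G2.
have adj2 (u v : G) : dist u v = 2%N -> exists2 z, adj u z & adj z v.
  by move=> d2; have := @dist_lt G u v; rewrite d2 => /(_ G2) /has_path2.
have XA : A = X by apply/eqP; rewrite eqEcard AX Aa Xa leqnn.
have f0 u v : (u \in X) = (v \in X) -> f u v = 0.
  move=> uv; rewrite /f; case: (boolP [&& _, _ & _]) => // /and3P[uS vT _].
  move: uv; rewrite (fintype.subsetP SX u uS).
  by have := fintype.subsetP TX v vT; rewrite inE => /negPf->.
have cliques (u v : G) : u != v -> (u \in X) = (v \in X) -> adj u v.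
  move=> uv uvX; apply: adj1; apply/eqP; rewrite -(eqr_nat R) tight /low !f0 //.
  by rewrite /base_dist uv /cl uvX eqxx mul0r !addr0.
have TX' v : v \in T -> v \notin X by move/(fintype.subsetP TX); rewrite inE.
(* A vertex [y] outside [X] and [T] is at distance 2 from [u]. No cut edge ends at [y], so the
   middle vertex of a shortest path is outside [X] and is a neighbour of [u] across the cut. *)
have coverS u : u \in S -> exists2 v, v \in T & adj u v.
  move=> uS; have uX := fintype.subsetP SX u uS.
  have [y] : exists y, y \in ~: X :\: T.
    apply/card_gt0P; rewrite cardsDS // Ts; clear -sa aX XX; lia.
  rewrite !inE => /andP[yT yX].
  have uy : u != y by apply: contraNneq yX => <-.
  have [|z uz zy] := adj2 u y.
    apply/eqP; rewrite -(eqr_nat R) tight /low /f (negPf yT) (negPf (SnT u uS)) !andbF /=.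
    rewrite /base_dist /cl uX (negPf yX) /bd uS (negPf yT).
    rewrite (negPf (contra (fintype.subsetP SX y) yX)) uy /=; apply/eqP; ring.
  have zX : z \notin X.
    apply/negP => zX; have [_] := crossST z y zX yX zy; by rewrite (negPf yT).
  by exists z => //; have [] := crossST u z uX zX uz.
have coverT v : v \in T -> exists2 u, u \in S & adj u v.
  move=> vT; have vX := TX' v vT.
  have [y] : exists y, y \in X :\: S.
    apply/card_gt0P; rewrite cardsDS // Ss; clear -sa aX; lia.
  rewrite !inE => /andP[yS yX].
  have yv : y != v by apply: contraNneq vX => <-.
  have yT : y \notin T by apply: contraTN yX => /TX'.
  have [|z yz zv] := adj2 y v.
    apply/eqP; rewrite -(eqr_nat R) tight /low /f (negPf yS) (negPf yT) !andbF /=.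
    rewrite /base_dist /cl yX (negPf vX) /bd vT (negPf yS) (negPf yT) orbT yv /=.
    by apply/eqP; ring.
  have zX : z \in X.
    by apply: contraNT yS => zX; have [] := crossST y z yX zX yz.
  by exists z => //; have [] := crossST z v zX vX zv.
by rewrite -Xa; apply: (two_cliques_iso G0 SX TX Ss Ts).
Qed.

End Bipartition.

Local Close Scope ring_scope.

Theorem theorem1p4 (R : realType) (k delta n : nat) (G : sgraph)
    (hk : 2 <= k)
    (hconn : connected_graph G)
    (hdeg : min_degree G = delta)
    (hdelta : 6 * k - 4 <= delta)
    (hord : #|G| = n)
    (hn : 2 * delta + 2 <= n)
    (hrho : (distance_spectral_radius R G <=
             distance_spectral_radius R (two_cliques n delta.+1 k.-1))%R) :
  k <= tau G \/ isomorphic G (two_cliques n delta.+1 k.-1).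
Proof.
have [|tk] := leqP k (tau G); [by left | right].
subst n; have G1 : 1 < #|G| by lia.
have dG (x : G) : delta <= #|[set y | adj x y]| by rewrite -hdeg min_degree_le.
case: (sparse_partition hk hdelta dG G1 tk) => [[X [dX XX cX]]| |].
- apply: (bipartition_radius _ _ dX XX _ hrho); lia.
- move=> [X [Y [XY dX [XleY XleZ] [cX _ _] c]]].
  have := three_parts_radius R hk hdelta XY dX XleY XleZ cX c.
  by rewrite ltNge hrho.
- move=> [X [Y [Z [XY XYZ dX [dZ dW cZ] [cX cY]]]]].
  have := four_parts_radius R hk hdelta XY XYZ dX dZ dW cZ cX cY.
  by rewrite ltNge hrho.
Qed.
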